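(* Fix $\sigma^2>0$. Locally uniformly in $\theta\in\mathbb H$ we have $$\lim_{n\to\infty}\frac1n\log\frac{H_n(-e^{i\theta};\sigma^2/n)}{(-1)^n}=\log\left(1+e^{2i\zeta_{\sigma^2/4}(\theta/2)}\right)-\frac{\sigma^2}{2\left(1+e^{-2i\zeta_{\sigma^2/4}(\theta/2)}\right)^2},$$ $$\lim_{n\to\infty}\frac1n\,\frac{H_n'(-e^{i\theta};\sigma^2/n)}{H_n(-e^{i\theta};\sigma^2/n)}=\frac{-e^{-i\theta}}{1+e^{-2i\zeta_{\sigma^2/4}(\theta/2)}}=-e^{-i\theta}\left(\frac i2\tan\zeta_{\sigma^2/4}(\theta/2)+\frac12\right).$$ Here the logarithms are chosen such that $\log1=0$ and all functions of the form $\log(\ldots)$ are continuous (and analytic) in $\theta\in\mathbb H$; that is, each logarithm is the continuous branch on $\mathbb H$ that tends to $0$ as $\operatorname{Im}\theta\to+\infty$ (where its argument tends to $1$).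
   Context: $\mathbb H=\{\theta\in\mathbb C:\operatorname{Im}\theta>0\}$. Unitary Hermite polynomials: for $n\in\mathbb N$ and $s>0$, $H_n(z;s)=\sum_{j=0}^n(-1)^{n-j}\binom nj \exp\{-\tfrac{s\,j(n-j)}{2}\}z^j$; $H_n'$ denotes the derivative in $z$. It is known (Lee--Yang theorem) that all zeroes of $H_n(\cdot;s)$ lie on the unit circle, so $H_n(-e^{i\theta};\sigma^2/n)\ne0$ for $\theta\in\mathbb H$. The function $\zeta_t$, $t>0$: it is known that for every $\theta\in\mathbb H$ the equation $\zeta-t\tan\zeta=\theta$ has a unique (simple) solution $\zeta=\zeta_t(\theta)$ in $\mathbb H$; the function $\zeta_t:\mathbb H\to\mathbb H$ is analytic, satisfies $\zeta_t(\theta+\pi)=\zeta_t(\theta)+\pi$, and $\zeta_t(\theta)-\theta\to it$ as $\operatorname{Im}\theta\to+\infty$, uniformly in $\operatorname{Re}\theta$. *)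

(* Defs.v *)
From Stdlib Require Import Reals.
From Coquelicot Require Import Coquelicot.

Open Scope R_scope.
Open Scope C_scope.

Definition Cexp (z : C) : C :=
  (exp (Re z) * cos (Im z), exp (Re z) * sin (Im z))%R.

Definition Csin (z : C) : C := (Cexp (Ci * z) - Cexp (- (Ci * z))) / (2 * Ci).

Definition Ccos (z : C) : C := (Cexp (Ci * z) + Cexp (- (Ci * z))) / 2.

Definition Ctan (z : C) : C := Csin z / Ccos z.

Definition upper_half_plane (z : C) : Prop := (0 < Im z)%R.

(* [Binomial.C n j] is the binomial coefficient; [sum_n _ n] has the n+1 terms
   j = 0, ..., n. *)
Definition unitary_hermite (n : nat) (s : R) (z : C) : C :=
  sum_n (fun j : nat =>
    (- (1)) ^ (n - j) * RtoC (Binomial.C n j) *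
    RtoC (exp (- (s * INR j * (INR n - INR j) / 2))) * z ^ j) n.

(* The equation has exactly one solution in the upper half-plane, so this
   determines [zeta] there; its values elsewhere are irrelevant. *)
Definition is_zeta (t : R) (zeta : C -> C) : Prop :=
  forall theta : C, upper_half_plane theta ->
    upper_half_plane (zeta theta) /\
    zeta theta - RtoC t * Ctan (zeta theta) = theta.

(* The filter "Im theta -> +oo", uniformly in Re theta. *)
Definition Im_to_infty (P : C -> Prop) : Prop :=
  exists M : R, forall theta : C, (M < Im theta)%R -> P theta.

(* As the half-plane is connected, two continuous logarithms of [f] differ by a
   constant in 2 i pi Z, and the condition at infinity selects one of them; it is
   analytic when [f] is. *)
Definition is_log_branch (f L : C -> C) : Prop :=
  (forall theta : C, upper_half_plane theta -> Cexp (L theta) = f theta) /\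
  (forall theta : C, upper_half_plane theta -> continuous L theta) /\
  filterlim L Im_to_infty (locally (RtoC 0)).

Definition locally_uniform_limit
    (D : C -> Prop) (f : nat -> C -> C) (g : C -> C) : Prop :=
  forall theta0 : C, D theta0 ->
    exists U : C -> Prop, locally theta0 U /\
      forall eps : R, (0 < eps)%R ->
        eventually (fun n : nat =>
          forall theta : C, D theta -> U theta ->
            (Cmod (f n theta - g theta) < eps)%R).

(* Main.v *)
Require Import Defs.
From Stdlib Require Import Reals Ranalysis5 Lra Lia List.
From Coquelicot Require Import Coquelicot.
From mathcomp Require ssreflect ssrfun ssrbool eqtype fintype ssrnat seq bigop ssralg poly ssrnum complex Rstruct.

(** Write [w = e^(i theta)], [c = sigma^2 / 2] and [q = e^(- c / n)].  Up to the sign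
    [(-1)^n], [H_n(- w)] is [hpoly n q w = sum_j C(n,j) q^(j (n - j)) w^j], and
    [hpoly (m+1) w = hpoly m (q w) (1 + bl m w)] with
    [bl m w = w q^m hpoly m (w / q) / hpoly m (q w)].  By induction on [m], [bl m] is a
    Blaschke product and all zeros of [hpoly (m+1)] lie outside the open unit disc.
    Moreover [w hpoly' / (n hpoly) = bl / (1 + bl)] for [bl = bl (n - 1) w].

    Comparing [bl (m+1) w], a product over the zeros of [hpoly (m+1)], factor by factor with
    an exponential gives, for [m] close to [n],
    [bl (m+1) w = w exp (- c (1 - bl m w) / (1 + bl m w)) + O(1 / n)].  The map
    [b |-> w exp (- c (1 - b) / (1 + b))] contracts the pseudo-hyperbolic distance of the disc
    (Schwarz-Pick, here an explicit inequality between [cosh] and [cos]), so [bl (n - 1) w]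
    tends to its fixed point, uniformly on [|w| <= r < 1].  That fixed point is
    [e^(2 i zeta (theta / 2))] because [tan zeta = i (1 - b) / (1 + b)] for
    [b = e^(2 i zeta)]: this is the second limit.

    For the first one, both sides are followed along [theta + i t], where they have the
    derivatives [- bl / (1 + bl)] and [- b / (1 + b)] in [t], and tend to 0 as [t] grows,
    uniformly in [n]. *)

Open Scope R_scope.
Open Scope C_scope.

(** * Factorization of complex polynomials *)

(** The recursion closes because the sum of [cayley] over the zeros of [hpoly (S m)], which the
    exponential approximation of [bl (S m)] requires, is a logarithmic derivative and hence a
    function of [bl m] alone; the distribution of the zeros never has to be found. The obstacle is
    that the map at step [m] carries the coupling [c (m + 1) / n] instead of [c]. So only the last
    [K] steps before [n - 1] are followed, with [K] fixed before [n]: there the couplings differ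
    from [c] by O(K / n), while the contraction forgets the unknown starting value. Schwarz-Pick
    gives a non-strict inequality; the strict factor comes from the multiplication by [w], and it
    degenerates as |w| tends to 1. Since [is_zeta] asserts no regularity of [zeta], Lipschitz
    dependence of the fixed point on [w] is extracted from the contraction, and along the ray
    increments with a uniform quadratic error take the place of derivatives. *)

Definition Lprod (f : C -> C) (a : list C) : C :=
  fold_right (fun x p => f x * p) 1 a.

Definition Lsum (f : C -> C) (a : list C) : C :=
  fold_right (fun x p => f x + p) 0 a.

Module ClosedFieldBridge.
Import ssreflect ssrfun ssrbool eqtype fintype ssrnat seq bigop ssralg poly ssrnum complex Rstruct.
Import GRing.Theory.
Local Open Scope ring_scope.

Definition toC (z : complex R) : C := let: Complex a b := z in (a, b).
Definition ofC (z : C) : complex R := Complex z.1 z.2.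

Lemma ofCK : cancel ofC toC. Proof. by case. Qed.
Lemma toCD x y : toC (x + y) = Cplus (toC x) (toC y).
Proof. by case: x y => a b [c d]. Qed.
Lemma toCM x y : toC (x * y) = Cmult (toC x) (toC y).
Proof. by case: x y => a b [c d]. Qed.
Lemma toCB x y : toC (x - y) = Cminus (toC x) (toC y).
Proof. by case: x y => a b [c d]. Qed.
Lemma toCX x n : toC (x ^+ n) = Cpow (toC x) n.
Proof. elim: n => [//|n IH]. by rewrite exprS toCM IH. Qed.


Lemma toC_sum (F : nat -> complex R) (m : nat) :
  toC (\sum_(j < m.+1) F j) = sum_n (fun j => toC (F j)) m.
Proof.
elim: m => [|m IH]; first by rewrite big_ord1 sum_O.
by rewrite big_ord_recr /= toCD IH sum_Sn.
Qed.

Lemma toC_prod (s : seq (complex R)) (w : complex R) :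
  toC (\prod_(z <- s) (1 - z * w)) =
  Lprod (fun x => Cminus (RtoC 1) (Cmult x (toC w))) (map toC s).
Proof.
elim: s => [|z s IH]; first by rewrite big_nil.
rewrite big_cons toCM IH /=; congr (Cmult _ _).
by rewrite toCB toCM.
Qed.

(** The reversed polynomial is monic because [c 0 = 1], so it splits into exactly [m] factors X - z
    even if the top coefficients of [c] vanish. Evaluating at the inverse of [w] and multiplying by
    the [m]-th power of [w] yields factors 1 - z w, with [z] a reciprocal zero; [w = 0] is checked
    directly. *)
Lemma reversed_poly_factor (c : nat -> complex R) (m : nat) : c 0%N = 1 ->
  exists2 s : seq (complex R), size s = m &
    forall w, \sum_(j < m.+1) c j * w ^+ j = \prod_(z <- s) (1 - z * w).
Proof.
move=> c0.
pose p := \poly_(i < m.+1) c (m - i)%N.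
have lp : lead_coef p = 1 by rewrite lead_coef_poly //= subnn c0 // oner_neq0.
have sp : size p = m.+1 by rewrite size_poly_eq //= subnn c0 oner_neq0.
have [s Ds] := closed_field_poly_normal p.
rewrite lp scale1r in Ds.
have ss : size s = m by apply: succn_inj; rewrite -sp Ds size_prod_XsubC.
exists s => // w.
have [->|w0] := eqVneq w 0.
  rewrite big_ord_recl expr0 c0 mulr1 big1 ?addr0; last first.
    by move=> i _; rewrite lift0 expr0n /= mulr0.
  by rewrite big1 // => z _; rewrite mulr0 subr0.
have -> : \sum_(j < m.+1) c j * w ^+ j = w ^+ m * p.[w^-1].
  rewrite horner_poly mulr_sumr (reindex_inj rev_ord_inj) /=.
  apply: eq_bigr => i _; rewrite subSS mulrCA; congr (_ * _).
  have im : (i <= m)%N by rewrite -ltnS.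
  have -> : w ^+ m = w ^+ (m - i) * w ^+ i by rewrite -exprD subnK.
  by rewrite -mulrA -exprMn divff // expr1n mulr1.
rewrite Ds horner_prod -ss.
elim: {Ds ss} s => [|z s IH]; first by rewrite !big_nil mulr1.
rewrite /= exprS !big_cons -IH hornerXsubC mulrACA; congr (_ * _).
by rewrite mulrBr divff // (mulrC w).
Qed.

Lemma poly_factor (c : nat -> C) (m : nat) : c 0%N = RtoC 1 ->
  exists a : list C, length a = m /\
    forall w : C, sum_n (fun j => Cmult (c j) (Cpow w j)) m =
      Lprod (fun x => Cminus (RtoC 1) (Cmult x w)) a.
Proof.
move=> c0.
have [|s ss Hs] := @reversed_poly_factor (fun j => ofC (c j)) m; first by rewrite c0.
exists (map toC s); split; first by rewrite length_map.
move=> w; rewrite -{2}(ofCK w) -toC_prod -Hs (toC_sum (fun j => ofC (c j) * ofC w ^+ j) m).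
by apply: sum_n_ext => j; rewrite toCM toCX !ofCK.
Qed.

End ClosedFieldBridge.

(** * The complex exponential *)

Lemma sq_le_le (x y : R) : (0 <= y)%R -> (x ^ 2 <= y ^ 2)%R -> (x <= y)%R.
Proof. intros. destruct (Rle_lt_dec x y); auto. nra. Qed.

Lemma Rdiv_le_of_le_mult (a b c : R) : (0 < c)%R -> (a <= b * c)%R -> (a / c <= b)%R.
Proof. intros H ?. now apply (Rle_div_l a b c H). Qed.

Lemma Rle_div_of_mult_le (a b c : R) : (0 < c)%R -> (a * c <= b)%R -> (a <= b / c)%R.
Proof. intros H ?. now apply (Rle_div_r a b c H). Qed.

Lemma Cmod_sq (z : C) : (Cmod z ^ 2 = fst z ^ 2 + snd z ^ 2)%R.
Proof. exact (Cmod2_alt z). Qed.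

Lemma Cmod_triangle_minus (x y : C) : (Cmod (x - y) <= Cmod x + Cmod y)%R.
Proof. rewrite <- (Cmod_opp y). apply Cmod_triangle. Qed.

Lemma Cmod_minus_ge (x y : C) : (Cmod x - Cmod y <= Cmod (x - y))%R.
Proof.
  generalize (Cmod_triangle (x - y) y).
  replace (x - y + y) with x by ring. lra.
Qed.

Lemma one_plus_neq_0 (b : C) : (Cmod b < 1)%R -> 1 + b <> 0.
Proof.
  intros H E. replace b with (- (1)) in H by (rewrite <- (Cplus_0_l (-(1))), <- E; ring).
  rewrite Cmod_m1 in H. lra.
Qed.

Lemma Cmod_one_plus_ge (b : C) (r : R) : (Cmod b <= r)%R -> (1 - r <= Cmod (1 + b))%R.
Proof.
  intros H. generalize (Cmod_minus_ge 1 (- b)). rewrite Cmod_1, Cmod_opp.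
  replace (1 - - b) with (1 + b) by ring. lra.
Qed.

Lemma exp_le (x y : R) : (x <= y -> exp x <= exp y)%R.
Proof. intros [H|H]; [left; now apply exp_increasing | right; now rewrite H]. Qed.

Lemma Cconj_RtoC (x : R) : Cconj x = x.
Proof. unfold Cconj, RtoC; simpl; f_equal; ring. Qed.

Lemma Cexp_plus (z z' : C) : Cexp (z + z') = Cexp z * Cexp z'.
Proof.
  destruct z as [a b], z' as [c d]. unfold Cexp, Cplus, Cmult; simpl.
  rewrite exp_plus, cos_plus, sin_plus. f_equal; ring.
Qed.

Lemma Cexp_0 : Cexp 0 = 1.
Proof. unfold Cexp; simpl. rewrite exp_0, cos_0, sin_0. unfold RtoC. f_equal; ring. Qed.

Lemma Cexp_neq_0 (z : C) : Cexp z <> 0.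
Proof.
  intros E. assert (H : Cexp (z + - z) = 1) by (rewrite Cplus_opp_r; apply Cexp_0).
  rewrite Cexp_plus, E, Cmult_0_l in H. injection H; lra.
Qed.

Lemma Cexp_opp (z : C) : Cexp (- z) = / Cexp z.
Proof.
  assert (H : Cexp z * Cexp (- z) = 1).
  { rewrite <- Cexp_plus, Cplus_opp_r. apply Cexp_0. }
  rewrite <- (Cmult_1_r (/ Cexp z)), <- H. field. apply Cexp_neq_0.
Qed.

Lemma Cmod_Cexp (z : C) : Cmod (Cexp z) = exp (fst z).
Proof.
  unfold Cmod, Cexp; simpl. fold (Re z) (Im z).
  transitivity (sqrt (exp (Re z) ^ 2)).
  - f_equal. generalize (sin2_cos2 (Im z)); unfold Rsqr; intros; simpl.
    transitivity (exp (Re z) * exp (Re z) * (sin (Im z) * sin (Im z) + cos (Im z) * cos (Im z)))%R.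
    ring. rewrite H. ring.
  - rewrite <- Rsqr_pow2. apply sqrt_Rsqr, Rlt_le, exp_pos.
Qed.

Lemma Cexp_RtoC (x : R) : Cexp (RtoC x) = RtoC (exp x).
Proof. unfold Cexp, RtoC; simpl. rewrite cos_0, sin_0. f_equal; ring. Qed.

(* Projecting on the direction of [f 1 - f 0] reduces this to the real mean value
   theorem without losing a constant. *)
Lemma C_mean_value (f df : R -> C) (K : R) :
  (forall t, (0 <= t <= 1)%R ->
     is_derive (fun s => fst (f s)) t (fst (df t)) /\
     is_derive (fun s => snd (f s)) t (snd (df t)) /\ (Cmod (df t) <= K)%R) ->
  (Cmod (f 1%R - f 0%R) <= K)%R.
Proof.
  intros H.
  set (u := f 1%R - f 0%R).
  set (phi := fun t => (fst u * fst (f t) + snd u * snd (f t))%R).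
  set (dphi := fun t => (fst u * fst (df t) + snd u * snd (df t))%R).
  assert (D : forall t, (0 <= t <= 1)%R -> is_derive phi t (dphi t)).
  { intros t Ht. destruct (H t Ht) as (H1 & H2 & _). unfold phi, dphi.
    apply (is_derive_plus (fun t => (fst u * fst (f t))%R) (fun t => (snd u * snd (f t))%R)).
    - now apply is_derive_scal.
    - now apply is_derive_scal. }
  assert (Hu : (Cmod u ^ 2 = phi 1 - phi 0)%R).
  { rewrite Cmod_sq. unfold phi, u. simpl. ring. }
  destruct (MVT_gen phi 0 1 dphi) as [c [Hc Ec]].
  - intros x. rewrite Rmin_left, Rmax_right by lra. intros. apply D; lra.
  - intros x. rewrite Rmin_left, Rmax_right by lra. intros.
    apply derivable_continuous_pt. exists (dphi x). apply is_derive_Reals, D; lra.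
  - rewrite Rmin_left, Rmax_right in Hc by lra.
    destruct (H c Hc) as (_ & _ & HK).
    assert (CS : (dphi c <= Cmod u * Cmod (df c))%R).
    { apply sq_le_le.
      - apply Rmult_le_pos; apply Cmod_ge_0.
      - rewrite Rpow_mult_distr, !Cmod_sq. unfold dphi.
        set (a := fst u); set (b := snd u); set (a' := fst (df c)); set (b' := snd (df c)).
        generalize (pow2_ge_0 (a * b' - a' * b)). nra. }
    rewrite Ec in Hu. generalize (Cmod_ge_0 u) (Cmod_ge_0 (df c)). intros P1 P2.
    destruct (Rle_lt_dec (Cmod u) K); auto.
    assert (Cmod u * Cmod (df c) <= Cmod u * K)%R by (apply Rmult_le_compat_l; lra).
    assert (Cmod u * K < Cmod u * Cmod u)%R by (apply Rmult_lt_compat_l; lra).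
    simpl in Hu. lra.
Qed.

Lemma Cexp_segment_derive (z0 z : C) (t : R) :
  is_derive (fun s : R => fst (Cexp (z0 + s * z))) t (fst (z * Cexp (z0 + t * z))) /\
  is_derive (fun s : R => snd (Cexp (z0 + s * z))) t (snd (z * Cexp (z0 + t * z))).
Proof.
  destruct z0 as [a b], z as [c d]. unfold Cexp; simpl.
  split; auto_derive; auto; unfold Rminus; ring.
Qed.

(** The half-plane Re <= K is convex and the derivative has modulus exp(Re) there. With [K = 0] the
    exponential is 1-Lipschitz on the left half-plane. *)
Lemma Cexp_lipschitz (z z' : C) (K : R) : (fst z <= K)%R -> (fst z' <= K)%R ->
  (Cmod (Cexp z - Cexp z') <= exp K * Cmod (z - z'))%R.
Proof.
  intros H H'.
  generalize (C_mean_value (fun t : R => Cexp (z' + t * (z - z')))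
    (fun t : R => (z - z') * Cexp (z' + t * (z - z'))) (exp K * Cmod (z - z'))).
  cbv beta. replace (z' + 1%R * (z - z')) with z by ring.
  replace (z' + 0%R * (z - z')) with z' by ring. intros M; apply M; clear M.
  intros t Ht. split; [|split]; try apply Cexp_segment_derive.
  rewrite Cmod_mult, Rmult_comm. apply Rmult_le_compat_r; [apply Cmod_ge_0|].
  rewrite Cmod_Cexp.
  apply exp_le. destruct z as [a b], z' as [c d]; simpl in *. nra.
Qed.

(** Mean value inequality for exp(t z) - t z, whose derivative z (exp(t z) - 1) is bounded by
    [Cexp_lipschitz]; [0 <= K] puts the point 0 in the same half-plane. *)
Lemma Cexp_taylor2 (z : C) (K : R) : (0 <= K)%R -> (fst z <= K)%R ->
  (Cmod (Cexp z - 1 - z) <= exp K * Cmod z ^ 2)%R.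
Proof.
  intros K0 H.
  generalize (C_mean_value (fun t : R => Cexp (0 + t * z) - t * z)
    (fun t : R => z * Cexp (0 + t * z) - z) (exp K * Cmod z ^ 2)).
  cbv beta. replace (0 + 1%R * z) with z by ring.
  replace (0 + 0%R * z) with (RtoC 0) by ring. rewrite Cexp_0.
  replace (Cexp z - 1%R * z - (1 - 0%R * z)) with (Cexp z - 1 - z) by ring.
  intros M; apply M; clear M.
  intros t Ht. destruct (Cexp_segment_derive 0 z t) as [D1 D2].
  split; [|split].
  - apply (is_derive_minus (fun s : R => fst (Cexp (0 + s * z))) (fun s : R => fst (s * z))); auto.
    destruct z; simpl. auto_derive; auto; ring.
  - apply (is_derive_minus (fun s : R => snd (Cexp (0 + s * z))) (fun s : R => snd (s * z))); auto.
    destruct z; simpl. auto_derive; auto; ring.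
  - replace (z * Cexp (0 + t * z) - z) with (z * (Cexp (t * z) - Cexp 0))
      by (rewrite Cexp_0, Cplus_0_l; ring).
    rewrite Cmod_mult.
    assert (L : (Cmod (Cexp (t * z) - Cexp 0) <= exp K * Cmod (t * z - 0))%R).
    { apply Cexp_lipschitz; destruct z; simpl in *; nra. }
    replace (t * z - 0) with (t * z) in L by ring.
    rewrite Cmod_mult, Cmod_R, Rabs_pos_eq in L by lra.
    generalize (Cmod_ge_0 z) (exp_pos K). intros.
    assert (t * Cmod z <= Cmod z)%R by nra.
    apply Rle_trans with (Cmod z * (exp K * (t * Cmod z)))%R.
    + now apply Rmult_le_compat_l.
    + replace (exp K * Cmod z ^ 2)%R with (Cmod z * (exp K * Cmod z))%R by ring.
      apply Rmult_le_compat_l; auto. apply Rmult_le_compat_l; lra.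
Qed.

(** * Contraction of the mean-field map *)

Lemma nondecreasing_of_derive (f df : R -> R) (a b : R) : (a <= b)%R ->
  (forall x, (a <= x <= b)%R -> is_derive f x (df x) /\ (0 <= df x)%R) -> (f a <= f b)%R.
Proof.
  intros Hab H.
  destruct (MVT_gen f a b df) as [c [Hc Ec]].
  - intros x. rewrite Rmin_left, Rmax_right by lra. intros. apply H; lra.
  - intros x. rewrite Rmin_left, Rmax_right by lra. intros.
    apply derivable_continuous_pt. exists (df x). apply is_derive_Reals, H; lra.
  - rewrite Rmin_left, Rmax_right in Hc by lra.
    destruct (H c Hc). nra.
Qed.

Lemma cosh_ge_1 (x : R) : (1 <= cosh x)%R.
Proof.
  unfold cosh. generalize (exp_pos x) (exp_pos (- x)). intros.
  assert (exp x * exp (- x) = 1)%R by (rewrite <- exp_plus, Rplus_opp_r; apply exp_0).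
  generalize (pow2_ge_0 (exp x - exp (- x))). intros.
  assert (4 <= (exp x + exp (- x)) ^ 2)%R by nra.
  nra.
Qed.

Lemma is_derive_cosh (x : R) : is_derive cosh x (sinh x).
Proof. unfold cosh, sinh. auto_derive; auto. field. Qed.

Lemma is_derive_sinh (x : R) : is_derive sinh x (cosh x).
Proof. unfold cosh, sinh. auto_derive; auto. field. Qed.

Lemma sinh_ge (x : R) : (0 <= x)%R -> (x <= sinh x)%R.
Proof.
  intros Hx.
  assert (sinh 0 - 0 <= sinh x - x)%R.
  { apply (nondecreasing_of_derive (fun x => sinh x - x)%R (fun x => cosh x - 1)%R); auto.
    intros y Hy. split; [|generalize (cosh_ge_1 y); lra].
    apply (is_derive_minus sinh (fun x : R => x)); [apply is_derive_sinh | auto_derive; auto]. }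
  rewrite sinh_0 in H. lra.
Qed.

Lemma cosh_diff_ge (a A : R) : (0 <= a <= A)%R -> ((A ^ 2 - a ^ 2) / 2 <= cosh A - cosh a)%R.
Proof.
  intros Ha.
  assert (cosh a - a ^ 2 / 2 <= cosh A - A ^ 2 / 2)%R; [|lra].
  apply (nondecreasing_of_derive (fun x => cosh x - x ^ 2 / 2)%R (fun x => sinh x - x)%R); [lra|].
  intros y Hy. split; [|generalize (sinh_ge y); lra].
  apply (is_derive_minus cosh (fun x : R => x ^ 2 / 2)%R); [apply is_derive_cosh|].
  auto_derive; auto; field.
Qed.

Lemma sinh_mult_le (t A : R) : (0 <= t <= 1)%R -> (0 <= A)%R -> (sinh (t * A) <= t * sinh A)%R.
Proof.
  intros Ht HA.
  assert (t * sinh 0 - sinh (t * 0) <= t * sinh A - sinh (t * A))%R.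
  { apply (nondecreasing_of_derive (fun x => t * sinh x - sinh (t * x))%R
      (fun x => t * (cosh x - cosh (t * x)))%R); auto.
    intros y Hy. split.
    - unfold sinh, cosh. auto_derive; auto; field.
    - apply Rmult_le_pos; [lra|].
      generalize (cosh_diff_ge (t * y) y). intros Q.
      assert (0 <= t * y <= y)%R by (split; nra).
      assert ((t * y) ^ 2 <= y ^ 2)%R by nra. specialize (Q H). lra. }
  rewrite Rmult_0_r, sinh_0 in H. lra.
Qed.

(** Division-free form of the monotonicity of (cosh x - 1) / x^2 for x > 0; the derivative in [A] of
    the difference of the two sides is controlled by [sinh_mult_le]. *)
Lemma cosh_mult_le (t A : R) : (0 <= t <= 1)%R -> (0 <= A)%R ->
  (cosh (t * A) - 1 <= t ^ 2 * (cosh A - 1))%R.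
Proof.
  intros Ht HA.
  assert (t ^ 2 * (cosh 0 - 1) - (cosh (t * 0) - 1) <=
          t ^ 2 * (cosh A - 1) - (cosh (t * A) - 1))%R.
  { apply (nondecreasing_of_derive (fun x => t ^ 2 * (cosh x - 1) - (cosh (t * x) - 1))%R
      (fun x => t * (t * sinh x - sinh (t * x)))%R); auto.
    intros y Hy. split.
    - unfold sinh, cosh. auto_derive; auto; field.
    - apply Rmult_le_pos; [lra|].
      generalize (sinh_mult_le t y). lra. }
  rewrite Rmult_0_r, cosh_0 in H. lra.
Qed.

Lemma one_minus_cos_le (d : R) : (1 - cos d <= d ^ 2 / 2)%R.
Proof.
  assert (P : forall x, (0 <= x -> 1 - cos x <= x ^ 2 / 2)%R).
  { intros x Hx.
    assert (cos 0 + 0 ^ 2 / 2 <= cos x + x ^ 2 / 2)%R.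
    { apply (nondecreasing_of_derive (fun x => cos x + x ^ 2 / 2)%R (fun x => x - sin x)%R); auto.
      intros y Hy. split; [auto_derive; auto; field|].
      destruct (Req_dec y 0) as [->|N]; [rewrite sin_0; lra|].
      generalize (sin_lt_x y). lra. }
    rewrite cos_0 in H. lra. }
  destruct (Rle_lt_dec 0 d); auto.
  generalize (P (- d)%R). rewrite cos_neg. intros Q.
  replace (d ^ 2)%R with ((- d) ^ 2)%R by ring. apply Q. lra.
Qed.

(** This says that (cosh x - cos d) / (x^2 + d^2) grows with |x|. Writing cosh x - cos d as (cosh x
    - 1) + (1 - cos d), the first part is [cosh_mult_le]; in the mixed terms, d^2 (cosh A - cosh x)
    is at least d^2 (A^2 - x^2) / 2, which dominates (1 - cos d) (A^2 - x^2). *)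
Lemma cosh_sub_cos_le (a A d : R) : (Rabs a <= A)%R ->
  ((cosh a - cos d) * (A ^ 2 + d ^ 2) <= (cosh A - cos d) * (a ^ 2 + d ^ 2))%R.
Proof.
  intros H.
  assert (Ea : cosh a = cosh (Rabs a)).
  { unfold Rabs; destruct Rcase_abs; auto. unfold cosh. rewrite Ropp_involutive. lra. }
  rewrite Ea, <- (pow2_abs a). generalize (Rabs_pos a). set (x := Rabs a) in *. clearbody x.
  clear a Ea. intros Hx.
  assert (Q1 : ((cosh x - 1) * A ^ 2 <= (cosh A - 1) * x ^ 2)%R).
  { destruct (Req_dec A 0) as [->|N].
    - replace x with 0%R by lra. lra.
    - generalize (cosh_mult_le (x / A) A). replace (x / A * A)%R with x by (field; auto).
      intros Q.
      assert (0 <= x / A <= 1)%R.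
      { split; [apply Rdiv_le_0_compat; lra|]. apply (Rdiv_le_1 x A); lra. }
      assert (L : (cosh x - 1 <= (x / A) ^ 2 * (cosh A - 1))%R) by (apply Q; lra).
      apply (Rmult_le_compat_r (A ^ 2)) in L; [|nra].
      replace ((x / A) ^ 2 * (cosh A - 1) * A ^ 2)%R with ((cosh A - 1) * x ^ 2)%R in L by (field; auto).
      exact L. }
  generalize (cosh_diff_ge x A (conj Hx H)) (one_minus_cos_le d). intros Q2 Q3.
  assert (0 <= A ^ 2 - x ^ 2)%R by nra.
  generalize (pow2_ge_0 d). intros Q4.
  assert ((1 - cos d) * (A ^ 2 - x ^ 2) <= d ^ 2 / 2 * (A ^ 2 - x ^ 2))%R
    by (apply Rmult_le_compat_r; lra).
  assert (d ^ 2 * ((A ^ 2 - x ^ 2) / 2) <= d ^ 2 * (cosh A - cosh x))%R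
    by (apply Rmult_le_compat_l; lra).
  lra.
Qed.

(* Schwarz-Pick for [u |-> exp (- u)], mapping the right half-plane to the unit disc. *)
Lemma Cexp_schwarz_pick (u v : C) : (0 < fst u)%R -> (0 < fst v)%R ->
  (Cmod (Cexp (- u) - Cexp (- v)) * Cmod (Cconj u + v) <=
   Cmod (u - v) * Cmod (1 - Cconj (Cexp (- u)) * Cexp (- v)))%R.
Proof.
  intros Hu Hv. apply sq_le_le; [apply Rmult_le_pos; apply Cmod_ge_0|].
  rewrite !Rpow_mult_distr, !Cmod_sq.
  destruct u as [p s], v as [p' s']; simpl in Hu, Hv.
  unfold Cexp, Cconj; cbn -[pow].
  (* With a = p - p', A = p + p' and d = s - s', the squared moduli of u - v and conj u + v are a^2
     + d^2 and A^2 + d^2. Those of the exponential difference and of its denominator are 2 exp(- A)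
     times cosh a - cos d and cosh A - cos d. *)
  assert (HA : (Rabs (p - p') <= p + p')%R) by (apply Rabs_le; lra).
  generalize (cosh_sub_cos_le _ _ (s - s') HA). unfold cosh.
  assert (Em : exp (p - p') = (exp p / exp p')%R)
    by (unfold Rminus, Rdiv; now rewrite exp_plus, exp_Ropp).
  rewrite cos_minus, !cos_neg, !sin_neg, !exp_Ropp, Em, !exp_plus.
  generalize (sin2_cos2 s) (sin2_cos2 s'); unfold Rsqr.
  generalize (exp_pos p) (exp_pos p'). clear Em.
  set (E := exp p); set (E' := exp p'); set (x := sin s); set (y := cos s);
  set (x' := sin s'); set (y' := cos s'). intros PE PE' S1 S2 M.
  apply (Rmult_le_compat_l (2 / (E * E'))%R) in M; [|left; apply Rdiv_lt_0_compat; nra].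
  eapply Rle_trans; [eapply Rle_trans; [|exact M]|]; right.
  - replace (((/ E * y + - (/ E' * y')) ^ 2 + (/ E * - x + - (/ E' * - x')) ^ 2)%R) with
      (((x * x + y * y) / (E * E) + (x' * x' + y' * y') / (E' * E')
        - 2 / (E * E') * (y * y' + x * x'))%R) by (field; lra).
    rewrite S1, S2. field; lra.
  - replace (((1 + - (/ E * y * (/ E' * y') - - (/ E * - x) * (/ E' * - x'))) ^ 2 +
     (0 + - (/ E * y * (/ E' * - x') + - (/ E * - x) * (/ E' * y'))) ^ 2)%R) with
     ((1 + (x * x + y * y) * (x' * x' + y' * y') / (E * E * E' * E')
        - 2 / (E * E') * (y * y' + x * x'))%R) by (field; lra).
    rewrite S1, S2. field; lra.
Qed.

(** * The mean-field map and the pseudo-hyperbolic distance *)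

Definition cayley (b : C) : C := (1 - b) / (1 + b).

Definition mean_field (c : R) (w b : C) : C := w * Cexp (- (c * cayley b)).

(** The pseudo-hyperbolic distance of the unit disc. *)
Definition rho (x y : C) : R := (Cmod (x - y) / Cmod (1 - Cconj x * y))%R.

Lemma Re_cayley (b : C) : (Cmod b < 1)%R ->
  fst (cayley b) = ((1 - Cmod b ^ 2) / Cmod (1 + b) ^ 2)%R.
Proof.
  intros H. generalize (one_plus_neq_0 b H). intros N.
  assert (P : (Cmod (1 + b) ^ 2 <> 0)%R).
  { apply pow_nonzero. apply Rgt_not_eq, Cmod_gt_0, N. }
  revert P. rewrite !Cmod_sq. destruct b as [x y].
  unfold cayley, Cdiv, Cinv; cbn -[pow]. intros P.
  field. simpl in *. contradict P. nra.
Qed.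

Lemma Re_cayley_pos (b : C) : (Cmod b < 1)%R -> (0 < fst (cayley b))%R.
Proof.
  intros H. rewrite (Re_cayley b H). apply Rdiv_lt_0_compat.
  - generalize (Cmod_ge_0 b). nra.
  - apply pow_lt. apply Cmod_gt_0, one_plus_neq_0, H.
Qed.

Lemma Cmod_lt_1_mult (x y : C) : (Cmod x < 1)%R -> (Cmod y < 1)%R ->
  (Cmod (Cconj x * y) < 1)%R.
Proof.
  intros Hx Hy. rewrite Cmod_mult, Cmod_conj.
  generalize (Cmod_ge_0 x) (Cmod_ge_0 y). nra.
Qed.

Lemma one_minus_neq_0 (b : C) : (Cmod b < 1)%R -> 1 - b <> 0.
Proof.
  intros H. replace (1 - b) with (1 + - b) by ring. apply one_plus_neq_0.
  now rewrite Cmod_opp.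
Qed.

Lemma rho_den_pos (x y : C) : (Cmod x < 1)%R -> (Cmod y < 1)%R ->
  (0 < Cmod (1 - Cconj x * y))%R.
Proof. intros. now apply Cmod_gt_0, one_minus_neq_0, Cmod_lt_1_mult. Qed.

Lemma rho_ge_0 (x y : C) : (Cmod x < 1)%R -> (Cmod y < 1)%R -> (0 <= rho x y)%R.
Proof.
  intros. apply Rdiv_le_0_compat; [apply Cmod_ge_0 | now apply rho_den_pos].
Qed.

Lemma rho_le_iff (x y : C) (k : R) : (Cmod x < 1)%R -> (Cmod y < 1)%R ->
  (Cmod (x - y) <= k * Cmod (1 - Cconj x * y))%R -> (rho x y <= k)%R.
Proof.
  intros Hx Hy H. apply Rdiv_le_of_le_mult; auto; now apply rho_den_pos.
Qed.

(** The Cayley transform is an isometry onto the right half-plane with its own pseudo-hyperbolic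
    distance |u - v| / |conj u + v|, here multiplied out. *)
Lemma rho_cayley (x y : C) : (Cmod x < 1)%R -> (Cmod y < 1)%R ->
  (Cmod (cayley x - cayley y) = rho x y * Cmod (Cconj (cayley x) + cayley y))%R.
Proof.
  intros Hx Hy.
  generalize (one_plus_neq_0 x Hx) (one_plus_neq_0 y Hy). intros Nx Ny.
  assert (Nx' : 1 + Cconj x <> 0) by (apply one_plus_neq_0; now rewrite Cmod_conj).
  assert (E1 : cayley x - cayley y = - 2 * (x - y) / ((1 + x) * (1 + y)))
    by (unfold cayley; field; auto).
  assert (E2 : Cconj (cayley x) + cayley y =
               2 * (1 - Cconj x * y) / ((1 + Cconj x) * (1 + y))).
  { unfold cayley. rewrite Cdiv_conj by auto. rewrite Cminus_conj, Cplus_conj.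
    rewrite Cconj_RtoC. field; auto. }
  assert (E3 : (Cmod (1 + Cconj x) = Cmod (1 + x))%R).
  { rewrite <- Cmod_conj. now rewrite Cplus_conj, Cconj_conj, Cconj_RtoC. }
  rewrite E1, E2, !Cmod_div, !Cmod_mult, E3 by (apply Cmult_neq_0; auto).
  rewrite !Cmod_R, (Rabs_left (-2)), (Rabs_pos_eq 2) by lra.
  generalize (rho_den_pos x y Hx Hy). unfold rho.
  apply Cmod_gt_0 in Nx, Ny. intros. field. repeat split; lra.
Qed.

(** The difference of the squares is (1 - t)^2 |1 + z|^2 + 2 (1 - t^2) (1 - |z|^2). Equality holds
    at z = -1. *)
Lemma one_minus_scaled_ge (t : R) (z : C) : (0 <= t <= 1)%R -> (Cmod z <= 1)%R ->
  ((1 + t) * Cmod (1 - z) <= 2 * Cmod (1 - t * z))%R.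
Proof.
  intros Ht Hz.
  apply sq_le_le; [generalize (Cmod_ge_0 (1 - t * z)); lra|].
  rewrite !Rpow_mult_distr, !Cmod_sq.
  assert (H : (fst z ^ 2 + snd z ^ 2 <= 1)%R).
  { rewrite <- Cmod_sq. generalize (Cmod_ge_0 z). nra. }
  destruct z as [x y]; cbn -[pow] in *.
  assert (0 <= (1 + x) ^ 2)%R by nra.
  assert (Hx : (-1 <= x <= 1)%R) by nra.
  set (p := (x ^ 2 + y ^ 2)%R) in *.
  assert (Hxp : (x ^ 2 <= p)%R) by (unfold p; nra).
  replace ((1 + - x) ^ 2 + (0 + - y) ^ 2)%R with (1 - 2 * x + p)%R by (unfold p; ring).
  replace ((1 + - (t * x - 0 * y)) ^ 2 + (0 + - (t * y + 0 * x)) ^ 2)%R with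
    (1 - 2 * t * x + t ^ 2 * p)%R by (unfold p; ring).
  clearbody p.
  assert (0 <= (1 - t) ^ 2 * (1 + 2 * x + p))%R by (apply Rmult_le_pos; nra).
  assert (0 <= (1 - t) * (1 + t) * (1 - p))%R by (apply Rmult_le_pos; nra).
  nra.
Qed.

(** The value of [rho] at r and - r, and the best constant in [rho_scale]. *)
Definition contraction_rate (r : R) : R := (2 * r / (1 + r ^ 2))%R.

Lemma contraction_rate_bounds (r : R) : (0 <= r < 1)%R ->
  (0 <= contraction_rate r < 1)%R.
Proof.
  intros Hr. unfold contraction_rate. split.
  - apply Rdiv_le_0_compat; nra.
  - apply (proj2 (Rlt_div_l (2 * r) 1 (1 + r ^ 2) ltac:(nra))); nra.
Qed.

Lemma contraction_rate_le (r r' : R) : (0 <= r <= r')%R -> (r' < 1)%R ->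
  (contraction_rate r <= contraction_rate r')%R.
Proof.
  intros Hr Hr'. unfold contraction_rate.
  apply Rdiv_le_of_le_mult; [nra|].
  replace (2 * r' / (1 + r' ^ 2) * (1 + r ^ 2))%R with
    ((2 * r' * (1 + r ^ 2)) / (1 + r' ^ 2))%R by (field; nra).
  apply Rle_div_of_mult_le; [nra|]. assert (r * r' <= 1)%R by nra.
  assert (0 <= (r' - r) * (1 - r * r'))%R by (apply Rmult_le_pos; lra). nra.
Qed.

(** With z = conj x y, the ratio of the two distances is |w| |1 - z| / |1 - |w|^2 z|, which
    [one_minus_scaled_ge] bounds at t = |w|^2. *)
Lemma rho_scale (w x y : C) (r : R) : (Cmod w <= r)%R -> (r < 1)%R ->
  (Cmod x < 1)%R -> (Cmod y < 1)%R ->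
  (rho (w * x) (w * y) <= contraction_rate r * rho x y)%R.
Proof.
  intros Hw Hr Hx Hy. generalize (Cmod_ge_0 w). intros Pw.
  assert (Hwx : (Cmod (w * x) < 1)%R) by (rewrite Cmod_mult; generalize (Cmod_ge_0 x); nra).
  assert (Hwy : (Cmod (w * y) < 1)%R) by (rewrite Cmod_mult; generalize (Cmod_ge_0 y); nra).
  apply Rle_trans with (contraction_rate (Cmod w) * rho x y)%R.
  2:{ apply Rmult_le_compat_r; [now apply rho_ge_0 | apply contraction_rate_le; lra]. }
  apply rho_le_iff; auto.
  replace (w * x - w * y) with (w * (x - y)) by ring. rewrite Cmod_mult.
  replace (Cconj (w * x) * (w * y)) with (RtoC (Cmod w ^ 2)%R * (Cconj x * y)).
  2:{ rewrite Cmod2_conj, Cmult_conj. ring. }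
  assert (Hz : (Cmod (Cconj x * y) <= 1)%R) by (left; now apply Cmod_lt_1_mult).
  generalize (one_minus_scaled_ge (Cmod w ^ 2) _ ltac:(nra) Hz). intros Q.
  generalize (rho_den_pos x y Hx Hy). unfold rho, contraction_rate.
  set (D := Cmod (1 - Cconj x * y)) in *. set (N := Cmod (x - y)).
  set (D' := Cmod (1 - RtoC (Cmod w ^ 2)%R * (Cconj x * y))) in *.
  assert (PN : (0 <= N)%R) by apply Cmod_ge_0. intros PD.
  set (m := Cmod w) in *.
  replace (2 * m / (1 + m ^ 2) * (N / D) * D')%R with
    (m * N * (2 * D' / ((1 + m ^ 2) * D)))%R by (field; nra).
  rewrite <- (Rmult_1_r (m * N)) at 1.
  apply Rmult_le_compat_l; [nra|].
  apply Rle_div_of_mult_le; nra.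
Qed.

Lemma mean_field_bound (c : R) (w b : C) : (0 <= c)%R -> (Cmod b < 1)%R ->
  (Cmod (mean_field c w b) <= Cmod w)%R.
Proof.
  intros Hc Hb. unfold mean_field. rewrite Cmod_mult, Cmod_Cexp.
  generalize (Cmod_ge_0 w) (Re_cayley_pos b Hb). intros Pw Pb.
  rewrite <- (Rmult_1_r (Cmod w)) at 2. apply Rmult_le_compat_l; auto.
  rewrite <- exp_0. apply exp_le. destruct (cayley b); simpl in *. nra.
Qed.

(** [cayley] is an isometry, scaling by [c > 0] is an isometry of the half-plane, the exponential
    does not expand, and only the final multiplication by [w] contracts strictly. *)
Lemma mean_field_contraction (c r : R) (w x y : C) : (0 < c)%R ->
  (Cmod w <= r)%R -> (r < 1)%R -> (Cmod x < 1)%R -> (Cmod y < 1)%R ->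
  (rho (mean_field c w x) (mean_field c w y) <= contraction_rate r * rho x y)%R.
Proof.
  intros Hc Hw Hr Hx Hy.
  assert (P : forall b, (Cmod b < 1)%R -> (0 < fst (c * cayley b)%C)%R).
  { intros b Hb. generalize (Re_cayley_pos b Hb). destruct (cayley b); simpl. nra. }
  assert (Q : forall b, (Cmod b < 1)%R -> (Cmod (Cexp (- (c * cayley b))) < 1)%R).
  { intros b Hb. rewrite Cmod_Cexp. rewrite <- exp_0. apply exp_increasing.
    generalize (P b Hb). destruct (c * cayley b); simpl; lra. }
  apply Rle_trans with
    (contraction_rate r * rho (Cexp (- (c * cayley x))) (Cexp (- (c * cayley y))))%R.
  { unfold mean_field. apply rho_scale; auto. }
  generalize (Cmod_ge_0 w). intros Pw.
  apply Rmult_le_compat_l; [apply contraction_rate_bounds; lra|].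
  apply rho_le_iff; auto.
  generalize (Cexp_schwarz_pick _ _ (P x Hx) (P y Hy)).
  replace (c * cayley x - c * cayley y) with (c * (cayley x - cayley y)) by ring.
  assert (Ec : Cconj (c * cayley x) + c * cayley y = c * (Cconj (cayley x) + cayley y)).
  { rewrite Cmult_conj, Cconj_RtoC. ring. }
  rewrite Ec, !Cmod_mult, rho_cayley by auto.
  rewrite Cmod_R, Rabs_pos_eq by lra.
  assert (PD : (0 < Cmod (Cconj (cayley x) + cayley y))%R).
  { apply Cmod_gt_0. intros E. apply (f_equal fst) in E.
    generalize (Re_cayley_pos x Hx) (Re_cayley_pos y Hy).
    destruct (cayley x), (cayley y); simpl in *. lra. }
  set (D := Cmod (Cconj (cayley x) + cayley y)) in *. intros I.
  assert (0 < c * D)%R by nra.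
  apply (Rmult_le_reg_r (c * D)); auto.
  eapply Rle_trans; [exact I|]. right; ring.
Qed.

(* [x |-> (x - y) / (1 - conj x y)] has the same modulus as a Moebius map, whose
   difference quotients are explicit; this replaces the triangle inequality for [rho]. *)
Lemma rho_perturb (r : R) (x x' y : C) : (r < 1)%R ->
  (Cmod x <= r)%R -> (Cmod x' <= r)%R -> (Cmod y <= r)%R ->
  (rho x' y <= rho x y + Cmod (x' - x) / (1 - r) ^ 2)%R.
Proof.
  intros Hr Hx Hx' Hy.
  assert (S : forall z, (Cmod z <= r)%R -> (1 - r <= Cmod (1 - Cconj y * z)%C)%R /\
    1 - Cconj y * z <> 0 /\ rho z y = Cmod ((z - y) / (1 - Cconj y * z))).
  { intros z Hz.
    assert (L : (Cmod (- (Cconj y * z)) <= r)%R).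
    { rewrite Cmod_opp, Cmod_mult, Cmod_conj. generalize (Cmod_ge_0 z) (Cmod_ge_0 y). nra. }
    assert (L1 := Cmod_one_plus_ge _ _ L).
    replace (1 + - (Cconj y * z)) with (1 - Cconj y * z) in L1 by ring.
    assert (N : 1 - Cconj y * z <> 0) by (apply Cmod_gt_0; lra).
    split; [|split]; auto.
    rewrite Cmod_div by auto. unfold rho. f_equal.
    rewrite <- (Cmod_conj (1 - Cconj z * y)). f_equal.
    rewrite Cminus_conj, Cmult_conj, Cconj_conj.
    rewrite Cconj_RtoC. ring. }
  destruct (S x Hx) as (L & N & ->), (S x' Hx') as (L' & N' & ->).
  assert (E : (x' - y) / (1 - Cconj y * x') =
    (x - y) / (1 - Cconj y * x) +
    (x' - x) * (1 - Cconj y * y) / ((1 - Cconj y * x') * (1 - Cconj y * x)))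
    by (field; auto).
  rewrite E. eapply Rle_trans; [apply Cmod_triangle|]. apply Rplus_le_compat_l.
  rewrite Cmod_div, !Cmod_mult by (apply Cmult_neq_0; auto).
  assert (Ly : (Cmod (1 - Cconj y * y) <= 1)%R).
  { rewrite Cmult_comm, <- Cmod2_conj, <- RtoC_minus, Cmod_R.
    generalize (Cmod_ge_0 y). intros. apply Rabs_le. nra. }
  generalize (Cmod_ge_0 (x' - x)) (Cmod_ge_0 (1 - Cconj y * y)). intros P1 P2.
  apply Rdiv_le_of_le_mult; [nra|].
  replace (Cmod (x' - x) / (1 - r) ^ 2 * (Cmod (1 - Cconj y * x') * Cmod (1 - Cconj y * x)))%R
    with (Cmod (x' - x) * ((Cmod (1 - Cconj y * x') * Cmod (1 - Cconj y * x)) / (1 - r) ^ 2))%R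
    by (field; nra).
  apply Rmult_le_compat_l; auto.
  apply Rle_trans with 1%R; auto.
  apply Rle_div_of_mult_le; nra.
Qed.

Lemma Cmod_minus_le_rho (x y : C) : (Cmod x < 1)%R -> (Cmod y < 1)%R ->
  (Cmod (x - y) <= 2 * rho x y)%R.
Proof.
  intros Hx Hy. generalize (rho_den_pos x y Hx Hy). intros PD.
  replace (Cmod (x - y)) with (rho x y * Cmod (1 - Cconj x * y))%R
    by (unfold rho; field; lra).
  rewrite Rmult_comm. apply Rmult_le_compat_r; [now apply rho_ge_0|].
  eapply Rle_trans; [apply Cmod_triangle_minus|]. rewrite Cmod_1.
  generalize (Cmod_lt_1_mult x y Hx Hy). lra.
Qed.

(** The bound keeps [b] inside the disc, within any radius that bounds [w]. *)
Definition fixed_point (c : R) (w b : C) : Prop :=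
  (Cmod b <= Cmod w)%R /\ b = mean_field c w b.

(** Comparing [b'] with [mean_field c w b'] costs |w' - w|, and the contraction lets [rho b' b] be
    absorbed on the left. The case w = w' gives uniqueness of the fixed point. *)
Lemma fixed_point_lipschitz (c r : R) (w w' b b' : C) : (0 < c)%R -> (0 <= r < 1)%R ->
  (Cmod w <= r)%R -> (Cmod w' <= r)%R -> fixed_point c w b -> fixed_point c w' b' ->
  (Cmod (b' - b) <= 2 / ((1 - r) ^ 2 * (1 - contraction_rate r)) * Cmod (w' - w))%R.
Proof.
  intros Hc Hr Hw Hw' [Hb Eb] [Hb' Eb'].
  assert (B := mean_field_bound c w b' ltac:(lra) ltac:(lra)).
  assert (I := rho_perturb r (mean_field c w b') b' b ltac:(lra) ltac:(lra) ltac:(lra) ltac:(lra)).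
  assert (I2 := mean_field_contraction c r w b' b Hc Hw ltac:(lra) ltac:(lra) ltac:(lra)).
  rewrite <- Eb in I2.
  assert (I3 : (Cmod (b' - mean_field c w b') <= Cmod (w' - w))%R).
  { rewrite Eb' at 1. unfold mean_field.
    replace (w' * Cexp (- (c * cayley b')) - w * Cexp (- (c * cayley b'))) with
      ((w' - w) * Cexp (- (c * cayley b'))) by ring.
    rewrite Cmod_mult. rewrite <- (Rmult_1_r (Cmod (w' - w))) at 2.
    apply Rmult_le_compat_l; [apply Cmod_ge_0|].
    rewrite Cmod_Cexp, <- exp_0. apply exp_le.
    generalize (Re_cayley_pos b' ltac:(lra)). destruct (cayley b'); simpl; nra. }
  assert (P := contraction_rate_bounds r Hr).
  assert (I4 := Cmod_minus_le_rho b' b ltac:(lra) ltac:(lra)).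
  assert (P2 : (0 < (1 - r) ^ 2)%R) by (apply pow_lt; lra).
  assert (I5 : (rho b' b * (1 - contraction_rate r) <= Cmod (w' - w) / (1 - r) ^ 2)%R).
  { apply (Rmult_le_compat_r (/ (1 - r) ^ 2)) in I3; [|left; now apply Rinv_0_lt_compat].
    unfold Rdiv in *. lra. }
  apply Rle_div_of_mult_le in I5; [|lra].
  replace (2 / ((1 - r) ^ 2 * (1 - contraction_rate r)) * Cmod (w' - w))%R with
    (2 * (Cmod (w' - w) / (1 - r) ^ 2 / (1 - contraction_rate r)))%R by (field; lra).
  lra.
Qed.

(** * Zeros of the unitary Hermite polynomials *)

(* The terms produced by [sum_n_ext_loc] live in the carrier of an algebraic structure,
   where [ring] and [field] do not recognize [C]. *)
Ltac as_C := match goal with |- @eq _ ?a ?b => change (@eq C a b) end.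

Definition hpoly (m : nat) (q : R) (w : C) : C :=
  sum_n (fun j => RtoC (Binomial.C m j * q ^ (j * (m - j)))%R * w ^ j) m.

(** The truncation [pred 0 = 0] is harmless: the term j = 0 carries the factor [INR 0]. *)
Definition dhpoly (m : nat) (q : R) (w : C) : C :=
  sum_n (fun j => RtoC (Binomial.C m j * q ^ (j * (m - j)))%R * (INR j * w ^ pred j)) m.

Lemma Csum_Sn (a : nat -> C) (m : nat) : sum_n a (S m) = sum_n a m + a (S m) :> C.
Proof. exact (sum_Sn a m). Qed.

Lemma Csum_shift (a : nat -> C) (m : nat) :
  sum_n a (S m) = a 0%nat + sum_n (fun i => a (S i)) m :> C.
Proof.
  induction m as [|m IH].
  - rewrite Csum_Sn, !sum_O. reflexivity.
  - rewrite Csum_Sn, IH, (Csum_Sn (fun i => a (S i))). ring.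
Qed.

Lemma Csum_plus (a b : nat -> C) (m : nat) :
  sum_n (fun i => a i + b i) m = sum_n a m + sum_n b m :> C.
Proof. exact (sum_n_plus a b m). Qed.

Lemma Csum_mult_l (k : C) (a : nat -> C) (m : nat) :
  sum_n (fun i => k * a i) m = k * sum_n a m :> C.
Proof. exact (sum_n_mult_l (K := C_Ring) k a m). Qed.

Lemma binom_0 (m : nat) : Binomial.C m 0 = 1%R.
Proof. unfold Binomial.C. rewrite Nat.sub_0_r. simpl. field. apply INR_fact_neq_0. Qed.

Lemma binom_n (m : nat) : Binomial.C m m = 1%R.
Proof. unfold Binomial.C. rewrite Nat.sub_diag. simpl. field. apply INR_fact_neq_0. Qed.

Lemma binom_absorb (m i : nat) : (i <= m)%nat ->
  (Binomial.C (S m) (S i) * INR (S i) = INR (S m) * Binomial.C m i)%R.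
Proof.
  intros H. unfold Binomial.C. rewrite Nat.sub_succ, !fact_simpl, !mult_INR.
  field. repeat split; try apply INR_fact_neq_0; apply not_0_INR; lia.
Qed.

(** Pascal's rule, with exponents matched by (i+1)(m-i) = i(m-i) + (m-i) = (i+1)(m-i-1) + (i+1): the
    argument [q w] supplies the last i+1, the prefactor with [w / q] the m-i. *)
Lemma hpoly_recurrence (m : nat) (q : R) (w : C) : q <> 0%R ->
  hpoly (S m) q w = hpoly m q (q * w) + w * (q ^ m * hpoly m q (w / q)).
Proof.
  intros Hq.
  assert (Hq' : RtoC q <> 0) by (intros E; apply Hq, RtoC_inj, E).
  (* [Binomial.C m (S m)] is not 0 but 1 / (m + 1), since natural subtraction truncates. The cut-off
     supplies the zero term that extends the first sum to [S m]. *)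
  set (b := fun j => if Nat.leb j m then Binomial.C m j else 0%R).
  set (t := fun j => RtoC (b j * q ^ (j * (m - j) + j))%R * w ^ j).
  assert (E1 : hpoly m q (q * w) = sum_n t (S m)).
  { rewrite Csum_Sn. unfold t at 2, b at 1.
    replace (Nat.leb (S m) m) with false by (symmetry; apply Nat.leb_gt; lia).
    rewrite Rmult_0_l, Cmult_0_l, Cplus_0_r. unfold hpoly. apply sum_n_ext_loc.
    intros j Hj. unfold t, b. replace (Nat.leb j m) with true by (symmetry; apply Nat.leb_le; lia).
    rewrite Cpow_mult_l, pow_add, !RtoC_mult, !RtoC_pow. as_C; ring. }
  assert (E2 : q ^ m * hpoly m q (w / q) =
    sum_n (fun i => RtoC (Binomial.C m i * q ^ (i * (m - i) + (m - i)))%R * w ^ i) m).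
  { unfold hpoly. rewrite <- Csum_mult_l. apply sum_n_ext_loc. intros i Hi.
    replace (RtoC q ^ m) with (RtoC q ^ (m - i) * RtoC q ^ i) by (rewrite <- Cpow_add_r; f_equal; lia).
    unfold Cdiv. rewrite Cpow_mult_l, Cpow_inv, pow_add, !RtoC_mult, !RtoC_pow by auto.
    as_C; field. now apply Cpow_nz. }
  rewrite E1, E2, (Csum_shift t), <- Csum_mult_l.
  unfold hpoly. rewrite Csum_shift, <- Cplus_assoc, <- Csum_plus. f_equal.
  - unfold t, b. simpl. now rewrite !binom_0.
  - apply sum_n_ext_loc. intros i Hi. unfold t, b.
    destruct (Nat.eq_dec i m) as [->|N].
    + replace (Nat.leb (S m) m) with false by (symmetry; apply Nat.leb_gt; lia).
      rewrite !binom_n, !Nat.sub_diag, !Nat.mul_0_r. simpl.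
      rewrite !Rmult_1_l, Rmult_0_l. as_C; ring.
    + replace (Nat.leb (S i) m) with true by (symmetry; apply Nat.leb_le; lia).
      rewrite <- (pascal m i) by lia.
      replace (S i * (S m - S i))%nat with (S i * (m - S i) + S i)%nat by nia.
      replace (i * (m - i) + (m - i))%nat with (S i * (m - S i) + S i)%nat by nia.
      rewrite Cpow_S, !RtoC_mult, !RtoC_plus. as_C; ring.
Qed.

(** By absorption, w times the derivative is m + 1 times the second summand of [hpoly_recurrence];
    this is why the logarithmic derivative is a function of [bl m]. *)
Lemma dhpoly_S (m : nat) (q : R) (w : C) : q <> 0%R ->
  dhpoly (S m) q w = INR (S m) * (q ^ m * hpoly m q (w / q)).
Proof.
  intros Hq.
  assert (Hq' : RtoC q <> 0) by (intros E; apply Hq, RtoC_inj, E).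
  unfold dhpoly, hpoly. rewrite Csum_shift, <- !Csum_mult_l.
  replace (INR 0) with 0%R by reflexivity. rewrite Cmult_0_l, Cmult_0_r, Cplus_0_l.
  apply sum_n_ext_loc. intros i Hi. rewrite Nat.pred_succ.
  transitivity (RtoC (Binomial.C (S m) (S i) * INR (S i))%R *
                (RtoC (q ^ (S i * (S m - S i)))%R * w ^ i)).
  { rewrite !RtoC_mult. as_C; ring. }
  rewrite binom_absorb by auto.
  replace (RtoC q ^ m) with (RtoC q ^ (m - i) * RtoC q ^ i) by (rewrite <- Cpow_add_r; f_equal; lia).
  replace (S i * (S m - S i))%nat with (i * (m - i) + (m - i))%nat by nia.
  unfold Cdiv. rewrite Cpow_mult_l, Cpow_inv, pow_add, !RtoC_mult, !RtoC_pow by auto.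
  as_C; field. now apply Cpow_nz.
Qed.

Lemma Cderive_pow (n : nat) (w : C) :
  is_derive (K := C_AbsRing) (V := AbsRing_NormedModule C_AbsRing) (fun z : C => z ^ n) w (INR n * w ^ pred n).
Proof.
  induction n as [|n IH].
  - apply (is_derive_ext (K := C_AbsRing) (V := AbsRing_NormedModule C_AbsRing) (fun _ : C => RtoC 1)); [reflexivity|].
    replace (INR 0 * w ^ pred 0) with (RtoC 0) by (simpl; ring).
    apply (is_derive_const (K := C_AbsRing) (V := AbsRing_NormedModule C_AbsRing)).
  - apply (is_derive_ext (K := C_AbsRing) (V := AbsRing_NormedModule C_AbsRing) (fun z : C => z * z ^ n)); [reflexivity|].
    replace (INR (S n) * w ^ pred (S n)) with (1 * w ^ n + w * (INR n * w ^ pred n)).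
    + apply (is_derive_mult (K := C_AbsRing) (fun z : C => z) (fun z : C => z ^ n)); auto.
      * apply (is_derive_id (K := C_AbsRing)).
      * exact Cmult_comm.
    + rewrite S_INR, RtoC_plus. destruct n; simpl; ring.
Qed.

Lemma hpoly_derive (m : nat) (q : R) (w : C) :
  is_derive (K := C_AbsRing) (V := AbsRing_NormedModule C_AbsRing) (hpoly m q) w (dhpoly m q w).
Proof.
  unfold hpoly, dhpoly.
  apply (is_derive_sum_n (K := C_AbsRing) (V := AbsRing_NormedModule C_AbsRing)
    (fun j (w : C) => RtoC (Binomial.C m j * q ^ (j * (m - j)))%R * w ^ j)).
  intros k _.
  set (c := RtoC _).
  apply (is_derive_ext (K := C_AbsRing) (V := AbsRing_NormedModule C_AbsRing)
    (fun z : C => z ^ k * c)); [intros; apply Cmult_comm|].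
  rewrite Cmult_comm.
  apply (is_derive_scal_l (K := C_AbsRing) (V := AbsRing_NormedModule C_AbsRing)
    (fun z : C => z ^ k)).
  apply Cderive_pow.
Qed.

Lemma C_derive_of_is_derive (f : C -> C) (z l : C) :
  is_derive (K := C_AbsRing) (V := AbsRing_NormedModule C_AbsRing) f z l -> C_derive f z = l.
Proof.
  intros [[L1 L2 L3] D]. apply is_C_derive_unique. split; [split|].
  - exact L1.
  - exact L2.
  - exact L3.
  - exact D.
Qed.

Lemma Lprod_derive (a : list C) (w : C) : (forall x, In x a -> 1 - x * w <> 0) ->
  is_derive (K := C_AbsRing) (V := AbsRing_NormedModule C_AbsRing)
    (fun z : C => Lprod (fun x => 1 - x * z) a) w
    (Lprod (fun x => 1 - x * w) a * Lsum (fun x => - x / (1 - x * w)) a).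
Proof.
  induction a as [|x a IH]; intros H; simpl.
  - rewrite Cmult_0_r.
    apply (is_derive_const (K := C_AbsRing) (V := AbsRing_NormedModule C_AbsRing)).
  - set (p := Lprod (fun x => 1 - x * w) a) in *. set (s := Lsum _ a) in *.
    replace ((1 - x * w) * p * (- x / (1 - x * w) + s)) with
      (- x * p + (1 - x * w) * (p * s)).
    2:{ field. apply H. now left. }
    apply (is_derive_mult (K := C_AbsRing) (fun z : C => 1 - x * z)
      (fun z : C => Lprod (fun x => 1 - x * z) a)).
    + replace (- x) with (0 - 1 * x) by ring.
      apply (is_derive_minus (K := C_AbsRing) (V := AbsRing_NormedModule C_AbsRing)
        (fun _ : C => RtoC 1) (fun z : C => x * z)).
      * apply (is_derive_const (K := C_AbsRing) (V := AbsRing_NormedModule C_AbsRing)).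
      * apply (is_derive_ext (K := C_AbsRing) (V := AbsRing_NormedModule C_AbsRing)
          (fun z : C => z * x)); [intros; apply Cmult_comm|].
        apply (is_derive_scal_l (K := C_AbsRing) (V := AbsRing_NormedModule C_AbsRing)
          (fun z : C => z)).
        apply (is_derive_id (K := C_AbsRing)).
    + apply IH. intros y Hy. apply H. now right.
    + exact Cmult_comm.
Qed.

Lemma Lprod_neq_0 (f : C -> C) (a : list C) :
  (forall x, In x a -> f x <> 0) -> Lprod f a <> 0.
Proof.
  induction a as [|x a IH]; intros H; simpl.
  - exact C1_nz.
  - apply Cmult_neq_0; [apply H; now left | apply IH; intros; apply H; now right].
Qed.

Lemma Lprod_eq_0 (f : C -> C) (a : list C) (x : C) :
  In x a -> f x = 0 -> Lprod f a = 0.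
Proof.
  induction a as [|y a IH]; simpl; [tauto|].
  intros [->|H] E; [rewrite E | rewrite IH by auto]; ring.
Qed.

Lemma Lprod_le_1 (f : C -> C) (a : list C) :
  (forall x, In x a -> (Cmod (f x) <= 1)%R) -> (Cmod (Lprod f a) <= 1)%R.
Proof.
  induction a as [|x a IH]; intros H; simpl.
  - rewrite Cmod_1. lra.
  - rewrite Cmod_mult. assert (H1 := H x (or_introl eq_refl)).
    assert (H2 := IH (fun y Hy => H y (or_intror Hy))).
    generalize (Cmod_ge_0 (f x)) (Cmod_ge_0 (Lprod f a)). nra.
Qed.

(** * Blaschke products and the location of the zeros *)

Definition blaschke_factor (q : R) (x : C) : C := (q - x) / (1 - q * x).

Lemma blaschke_den (q : R) (x : C) : (0 < q < 1)%R -> (Cmod x < 1)%R -> 1 - q * x <> 0.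
Proof.
  intros Hq Hx. apply one_minus_neq_0. rewrite Cmod_mult, Cmod_R, Rabs_pos_eq by lra. nra.
Qed.

Lemma blaschke_factor_le_1 (q : R) (x : C) : (0 < q < 1)%R -> (Cmod x < 1)%R ->
  (Cmod (blaschke_factor q x) <= 1)%R.
Proof.
  intros Hq Hx. assert (N := blaschke_den q x Hq Hx).
  unfold blaschke_factor. rewrite Cmod_div by auto.
  apply Rdiv_le_of_le_mult; [now apply Cmod_gt_0|]. rewrite Rmult_1_l.
  apply sq_le_le; [apply Cmod_ge_0|].
  assert (H : (fst x ^ 2 + snd x ^ 2 <= 1)%R).
  { rewrite <- Cmod_sq. generalize (Cmod_ge_0 x). nra. }
  rewrite !Cmod_sq. destruct x as [s t]; cbn -[pow] in *.
  assert (0 <= (1 - q ^ 2) * (1 - (s ^ 2 + t ^ 2)))%R by (apply Rmult_le_pos; nra).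
  nra.
Qed.

(** Each factor takes one [q] from the power: q (1 - x w / q) = q - x w is the numerator of
    [blaschke_factor q (x * w)]. *)
Lemma Lprod_blaschke (q : R) (a : list C) (w : C) : (0 < q < 1)%R -> (Cmod w < 1)%R ->
  (forall x, In x a -> (Cmod x <= 1)%R) ->
  q ^ length a * Lprod (fun x => 1 - x * (w / q)) a =
  Lprod (fun x => 1 - x * (q * w)) a * Lprod (fun x => blaschke_factor q (x * w)) a.
Proof.
  intros Hq Hw. induction a as [|x a IH]; intros H; simpl; [ring|].
  assert (Hx : (Cmod (x * w) < 1)%R).
  { rewrite Cmod_mult. generalize (H x (or_introl eq_refl)) (Cmod_ge_0 x) (Cmod_ge_0 w). nra. }
  assert (N := blaschke_den q (x * w) Hq Hx).
  assert (Hq' : RtoC q <> 0) by (intros E; apply RtoC_inj in E; lra).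
  transitivity (q * (1 - x * (w / q)) * (q ^ length a * Lprod (fun x => 1 - x * (w / q)) a)).
  { ring. }
  rewrite IH by (intros; apply H; now right).
  unfold blaschke_factor. field. auto.
Qed.

(** [a] lists reciprocals of zeros, so |x| <= 1 places the zeros outside the open disc. *)
Definition roots_in_disc (m : nat) (q : R) (a : list C) : Prop :=
  length a = m /\ (forall x, In x a -> (Cmod x <= 1)%R) /\
  forall w, hpoly m q w = Lprod (fun x => 1 - x * w) a.

Lemma roots_in_disc_factor (m : nat) (q : R) (a : list C) (x w : C) :
  roots_in_disc m q a -> In x a -> (Cmod w < 1)%R -> (Cmod (x * w) < 1)%R.
Proof.
  intros (_ & H & _) Hx Hw. rewrite Cmod_mult.
  generalize (H x Hx) (Cmod_ge_0 x) (Cmod_ge_0 w). nra.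
Qed.

Lemma roots_in_disc_neq_0 (m : nat) (q : R) (a : list C) (w : C) :
  roots_in_disc m q a -> (Cmod w < 1)%R -> hpoly m q w <> 0.
Proof.
  intros H Hw. rewrite (proj2 (proj2 H)). apply Lprod_neq_0. intros x Hx.
  apply one_minus_neq_0. now apply (roots_in_disc_factor m q a).
Qed.

(* [bl m q w] is a finite Blaschke product in [w], of degree [m + 1] and vanishing at 0. *)
Definition bl (m : nat) (q : R) (w : C) : C :=
  w * (q ^ m * hpoly m q (w / q) / hpoly m q (q * w)).

Lemma Cmod_scale_lt (q : R) (w : C) : (0 < q < 1)%R -> (Cmod w < 1)%R -> (Cmod (q * w) < 1)%R.
Proof. intros Hq Hw. rewrite Cmod_mult, Cmod_R, Rabs_pos_eq by lra. generalize (Cmod_ge_0 w). nra. Qed.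

Lemma bl_product (m : nat) (q : R) (a : list C) (w : C) : (0 < q < 1)%R ->
  roots_in_disc m q a -> (Cmod w < 1)%R ->
  bl m q w = w * Lprod (fun x => blaschke_factor q (x * w)) a.
Proof.
  intros Hq Ha Hw. assert (N := roots_in_disc_neq_0 m q a _ Ha (Cmod_scale_lt q w Hq Hw)).
  unfold bl. destruct Ha as (L & H & E). rewrite !E in *. rewrite <- L.
  rewrite Lprod_blaschke by auto. field; auto.
Qed.

Lemma bl_bound (m : nat) (q : R) (a : list C) (w : C) : (0 < q < 1)%R ->
  roots_in_disc m q a -> (Cmod w < 1)%R -> (Cmod (bl m q w) <= Cmod w)%R.
Proof.
  intros Hq Ha Hw. rewrite (bl_product m q a w Hq Ha Hw), Cmod_mult.
  rewrite <- (Rmult_1_r (Cmod w)) at 2. apply Rmult_le_compat_l; [apply Cmod_ge_0|].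
  apply Lprod_le_1. intros x Hx. apply blaschke_factor_le_1; auto.
  now apply (roots_in_disc_factor m q a).
Qed.

Lemma hpoly_S_bl (m : nat) (q : R) (a : list C) (w : C) : (0 < q < 1)%R ->
  roots_in_disc m q a -> (Cmod w < 1)%R ->
  hpoly (S m) q w = hpoly m q (q * w) * (1 + bl m q w).
Proof.
  intros Hq Ha Hw. rewrite hpoly_recurrence by lra. unfold bl. field.
  apply (roots_in_disc_neq_0 m q a); auto. now apply Cmod_scale_lt.
Qed.

(* The Lee-Yang theorem, by induction on the degree: [bl] maps the disc to itself, so
   [1 + bl] has no zero there. *)
Lemma lee_yang (m : nat) (q : R) : (0 < q < 1)%R -> exists a, roots_in_disc m q a.
Proof.
  intros Hq. induction m as [|m [a Ha]].
  - exists nil. split; [reflexivity|]. split; [intros x []|].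
    intros w. unfold hpoly. rewrite sum_O. simpl. rewrite binom_0. as_C.
    rewrite Rmult_1_l. ring.
  - destruct (ClosedFieldBridge.poly_factor (fun j => RtoC (Binomial.C (S m) j * q ^ (j * (S m - j)))%R) (S m))
      as [a' [L E]].
    { rewrite binom_0. simpl. now rewrite Rmult_1_l. }
    exists a'. split; [exact L|]. split; [|exact E].
    intros x Hx. destruct (Rle_lt_dec (Cmod x) 1) as [|G]; auto. exfalso.
    assert (Nx : x <> 0) by (apply Cmod_gt_0; lra).
    assert (Hw : (Cmod (/ x) < 1)%R).
    { rewrite Cmod_inv by auto. rewrite <- Rinv_1. apply Rinv_lt_contravar; lra. }
    assert (Z : hpoly (S m) q (/ x) = 0).
    { unfold hpoly. rewrite E. apply (Lprod_eq_0 _ _ x Hx). field; auto. }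
    rewrite (hpoly_S_bl m q a) in Z by auto. revert Z. apply Cmult_neq_0.
    + apply (roots_in_disc_neq_0 m q a); auto. now apply Cmod_scale_lt.
    + apply one_plus_neq_0. eapply Rle_lt_trans; [apply (bl_bound m q a); auto | auto].
Qed.

Lemma dhpoly_over_hpoly (m : nat) (q : R) (w : C) : (0 < q < 1)%R -> (Cmod w < 1)%R ->
  w * dhpoly (S m) q w / hpoly (S m) q w = INR (S m) * (bl m q w / (1 + bl m q w)).
Proof.
  intros Hq Hw. destruct (lee_yang m q Hq) as [a Ha].
  assert (N := roots_in_disc_neq_0 m q a _ Ha (Cmod_scale_lt q w Hq Hw)).
  assert (N' : 1 + bl m q w <> 0).
  { apply one_plus_neq_0. eapply Rle_lt_trans; [apply (bl_bound m q a); auto | auto]. }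
  rewrite (hpoly_S_bl m q a), dhpoly_S by (auto; lra).
  revert N'. unfold bl. intros. field. split; auto.
  contradict N'. rewrite <- (Cmult_0_l (/ hpoly m q (q * w))), <- N'. field; auto.
Qed.

(** The logarithmic derivative computed in two ways, from the factorization and from
    [dhpoly_over_hpoly]; it evaluates a sum over unknown zeros. *)
Lemma Lsum_roots (m : nat) (q : R) (a : list C) (w : C) : (0 < q < 1)%R ->
  roots_in_disc (S m) q a -> (Cmod w < 1)%R ->
  w * Lsum (fun x => - x / (1 - x * w)) a = INR (S m) * (bl m q w / (1 + bl m q w)).
Proof.
  intros Hq Ha Hw. rewrite <- dhpoly_over_hpoly by auto.
  assert (N := roots_in_disc_neq_0 _ _ _ _ Ha Hw).
  assert (D : dhpoly (S m) q w = hpoly (S m) q w * Lsum (fun x => - x / (1 - x * w)) a).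
  { rewrite <- (C_derive_of_is_derive _ _ _ (hpoly_derive (S m) q w)).
    destruct (Ha) as (L & H & E).
    apply C_derive_of_is_derive. rewrite E.
    eapply (is_derive_ext (K := C_AbsRing) (V := AbsRing_NormedModule C_AbsRing)).
    { intros t. symmetry. apply E. }
    apply Lprod_derive. intros x Hx. apply one_minus_neq_0.
    now apply (roots_in_disc_factor (S m) q a). }
  rewrite D. field; auto.
Qed.

(** * Convergence to the fixed point *)

(** Telescoping: as all factors have modulus at most 1, the errors only add. *)
Lemma Lprod_diff (f g : C -> C) (a : list C) (K : R) :
  (forall x, In x a -> (Cmod (f x) <= 1)%R /\ (Cmod (g x) <= 1)%R /\ (Cmod (f x - g x) <= K)%R) ->
  (Cmod (Lprod f a - Lprod g a) <= INR (length a) * K)%R.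
Proof.
  induction a as [|x a IH]; intros H.
  - simpl. replace (1 - 1) with (RtoC 0) by ring. rewrite Cmod_0. lra.
  - assert (Ha : forall y, In y a -> (Cmod (f y) <= 1)%R /\ (Cmod (g y) <= 1)%R /\
      (Cmod (f y - g y) <= K)%R) by (intros; apply H; now right).
    specialize (IH Ha). destruct (H x (or_introl eq_refl)) as (H1 & H2 & H3).
    cbn [length]. rewrite S_INR. simpl.
    replace (f x * Lprod f a - g x * Lprod g a) with
      ((f x - g x) * Lprod f a + g x * (Lprod f a - Lprod g a)) by ring.
    eapply Rle_trans; [apply Cmod_triangle|]. rewrite !Cmod_mult.
    assert (L : (Cmod (Lprod f a) <= 1)%R) by (apply Lprod_le_1; intros; now apply Ha).
    generalize (Cmod_ge_0 (f x - g x)) (Cmod_ge_0 (Lprod f a - Lprod g a))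
      (Cmod_ge_0 (Lprod f a)) (Cmod_ge_0 (g x)). nra.
Qed.

Lemma Lprod_Cexp (f : C -> C) (a : list C) : Lprod (fun x => Cexp (f x)) a = Cexp (Lsum f a).
Proof.
  induction a as [|x a IH]; simpl; [now rewrite Cexp_0 | now rewrite IH, Cexp_plus].
Qed.

Lemma Lsum_scal (k : C) (f : C -> C) (a : list C) : Lsum (fun x => k * f x) a = k * Lsum f a.
Proof. induction a as [|x a IH]; simpl; [ring | rewrite IH; ring]. Qed.

Lemma Lsum_ext_in (f g : C -> C) (a : list C) :
  (forall x, In x a -> f x = g x) -> Lsum f a = Lsum g a.
Proof.
  induction a as [|x a IH]; intros H; simpl; auto.
  rewrite (H x), IH; auto; [intros; apply H; now right | now left].
Qed.

Lemma Lsum_affine (k : C) (f : C -> C) (a : list C) :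
  Lsum (fun x => 1 + k * f x) a = INR (length a) + k * Lsum f a.
Proof.
  induction a as [|x a IH]; [simpl; ring|].
  cbn [length]. rewrite S_INR, RtoC_plus. simpl. rewrite IH. ring.
Qed.

(** Since cayley b = 1 - 2 b / (1 + b), this is an affine form of [Lsum_roots]: the average of
    [cayley] over the factors is [cayley] of [bl m]. *)
Lemma cayley_roots (m : nat) (q : R) (a : list C) (w : C) : (0 < q < 1)%R ->
  roots_in_disc (S m) q a -> (Cmod w < 1)%R ->
  Lsum (fun x => cayley (- (x * w))) a = INR (S m) * cayley (bl m q w).
Proof.
  intros Hq Ha Hw.
  destruct (lee_yang m q Hq) as [a' Ha'].
  assert (N : 1 + bl m q w <> 0).
  { apply one_plus_neq_0. eapply Rle_lt_trans; [apply (bl_bound m q a'); auto | auto]. }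
  rewrite (Lsum_ext_in _ (fun x => 1 + (- (2) * w) * (- x / (1 - x * w)))).
  - rewrite Lsum_affine, (proj1 Ha).
    replace (- (2) * w * Lsum (fun x : C => - x / (1 - x * w)) a) with
      (- (2) * (w * Lsum (fun x : C => - x / (1 - x * w)) a)) by ring.
    rewrite (Lsum_roots m q a w) by auto. unfold cayley. field; auto.
  - intros x Hx. unfold cayley.
    assert (Nx : 1 - x * w <> 0) by (apply one_minus_neq_0; now apply (roots_in_disc_factor (S m) q a)).
    field; auto.
Qed.

Lemma cayley_bound (b : C) (r : R) : (Cmod b <= r)%R -> (r < 1)%R ->
  (Cmod (cayley b) <= 2 / (1 - r))%R.
Proof.
  intros Hb Hr. assert (L := Cmod_one_plus_ge b r Hb).
  unfold cayley. rewrite Cmod_div by (apply one_plus_neq_0; lra).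
  generalize (Cmod_triangle_minus 1 b). rewrite Cmod_1. intros T.
  apply Rdiv_le_of_le_mult; [lra|].
  apply Rle_trans with (2 / (1 - r) * (1 - r))%R.
  - field_simplify; lra.
  - apply Rmult_le_compat_l; auto. apply Rdiv_le_0_compat; lra.
Qed.

(** The fraction is tanh (e / 2); everything follows from 1 - e <= exp(- e) <= 1 / (1 + e). *)
Lemma tanh_half_approx (e : R) : (0 <= e <= 1)%R ->
  (0 <= (1 - exp (- e)) / (1 + exp (- e)) <= e /\
   Rabs (2 * ((1 - exp (- e)) / (1 + exp (- e))) - e) <= e ^ 2)%R.
Proof.
  intros He.
  assert (H1 : (1 - e <= exp (- e))%R) by (generalize (exp_ineq1_le (- e)); lra).
  assert (H2 : (exp (- e) * (1 + e) <= 1)%R).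
  { rewrite exp_Ropp. generalize (exp_ineq1_le e) (exp_pos e). intros.
    apply (Rmult_le_reg_l (exp e)); auto. field_simplify; lra. }
  generalize (exp_pos (- e)). set (q := exp (- e)) in *. intros P.
  assert (q <= 1)%R by nra.
  split; [split|].
  - apply Rdiv_le_0_compat; lra.
  - apply Rdiv_le_of_le_mult; nra.
  - replace (2 * ((1 - q) / (1 + q)) - e)%R with ((2 * (1 - q) - e * (1 + q)) / (1 + q))%R
      by (field; lra).
    unfold Rdiv. rewrite Rabs_mult, (Rabs_pos_eq (/ (1 + q))) by (left; apply Rinv_0_lt_compat; lra).
    apply Rdiv_le_of_le_mult; [lra|]. apply Rabs_le. split; nra.
Qed.

(* In the variable [y = (1 + z) / (1 - z)] the factor is [(1 - k y) / (1 + k y)] with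
   [k = tanh (e / 2)], which agrees with [exp (- e y)] to first order in [e]. *)
Lemma blaschke_factor_approx (e r : R) (z : C) : (0 < e <= 1)%R -> (0 <= r < 1)%R ->
  (Cmod z <= r)%R ->
  (Cmod (blaschke_factor (exp (- e)) z - Cexp (- (e * cayley (- z)))) <=
   4 * (2 / (1 - r)) ^ 2 * e ^ 2)%R.
Proof.
  intros He Hr Hz.
  assert (Hz' : (Cmod (- z) <= r)%R) by (now rewrite Cmod_opp).
  assert (B := cayley_bound _ r Hz' (proj2 Hr)).
  assert (Py : (0 < fst (cayley (- z)))%R) by (apply Re_cayley_pos; lra).
  destruct (tanh_half_approx e ltac:(lra)) as [K1 K2].
  assert (Hq : (0 < exp (- e) < 1)%R).
  { split; [apply exp_pos|]. rewrite <- exp_0. apply exp_increasing; lra. }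
  set (q := exp (- e)) in *. set (k := ((1 - q) / (1 + q))%R) in *.
  set (y := cayley (- z)) in *. set (Y := (2 / (1 - r))%R) in *.
  assert (Nz : 1 - z <> 0) by (apply one_minus_neq_0; lra).
  assert (Nq : 1 - q * z <> 0) by (apply blaschke_den; lra).
  assert (N1 : RtoC 1 + q <> 0).
  { rewrite <- RtoC_plus. intros E. apply RtoC_inj in E. lra. }
  assert (Eky : 1 + k * y = 2 * (1 - q * z) / ((1 + q) * (1 - z))).
  { unfold k, y, cayley. rewrite RtoC_div, RtoC_minus, RtoC_plus by lra. field.
    repeat split; auto. }
  assert (N2 : RtoC 2 <> 0) by (intros E; apply RtoC_inj in E; lra).
  assert (Nky : 1 + k * y <> 0).
  { rewrite Eky. intros E. revert Nq. apply f_equal with (f := fun x => x * ((1 + q) * (1 - z)) / 2) in E.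
    intros Nq. apply Nq. replace (1 - q * z) with
      (2 * (1 - q * z) / ((1 + q) * (1 - z)) * ((1 + q) * (1 - z)) / 2) by (field; auto).
    rewrite E. field; auto. }
  (* The expansion (1 - u) / (1 + u) = 1 - 2 u + 2 u^2 / (1 + u) with u = k y. As Re y > 0, the last
     denominator has modulus at least 1. *)
  assert (Eu : blaschke_factor q z = 1 - 2 * (k * y) + 2 * (k * y) ^ 2 / (1 + k * y)).
  { transitivity ((1 - k * y) / (1 + k * y)); [|field; auto].
    assert (Emy : 1 - k * y = 2 * (q - z) / ((1 + q) * (1 - z))).
    { unfold k, y, cayley. rewrite RtoC_div, RtoC_minus, RtoC_plus by lra. field.
      repeat split; auto. }
    rewrite Eky, Emy. unfold blaschke_factor. field. auto. }
  assert (D : (1 <= Cmod (1 + k * y))%R).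
  { apply Rle_trans with (Rabs (Re (1 + k * y))); [|apply re_le_Cmod].
    eapply Rle_trans; [|apply Rle_abs]. destruct y; simpl in *. nra. }
  assert (T := Cexp_taylor2 (- (e * y)) 0 (Rle_refl 0)).
  rewrite exp_0, Rmult_1_l in T.
  assert (T' : (Cmod (Cexp (- (e * y)) - 1 - - (e * y)) <= Cmod (- (e * y)) ^ 2)%R).
  { apply T. destruct y; simpl in *; nra. }
  clear T.
  replace (blaschke_factor q z - Cexp (- (e * y))) with
    (2 * (k * y) ^ 2 / (1 + k * y) - RtoC (2 * k - e) * y
      - (Cexp (- (e * y)) - 1 - - (e * y)))
    by (rewrite Eu, RtoC_minus, RtoC_mult; ring).
  eapply Rle_trans; [apply Cmod_triangle_minus|].
  rewrite Cmod_opp, Cmod_mult, Cmod_R, (Rabs_pos_eq e) in T' by lra.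
  (* This turns the error e^2 Y into e^2 Y^2, so that the three errors, with weights 2, 1 and 1, add
     up to the constant 4. *)
  assert (HY : (2 <= Y)%R).
  { unfold Y. apply Rle_div_of_mult_le; lra. }
  generalize (Cmod_ge_0 y). intros P0.
  assert (A1 : (Cmod (2 * (k * y) ^ 2 / (1 + k * y)) <= 2 * (e * Y) ^ 2)%R).
  { rewrite Cmod_div by auto. apply Rdiv_le_of_le_mult; [lra|].
    rewrite Cmod_mult, Cmod_pow, Cmod_mult, !Cmod_R, (Rabs_pos_eq 2), (Rabs_pos_eq k) by lra.
    assert (0 <= k * Cmod y <= e * Y)%R by (split; [nra | apply Rmult_le_compat; lra]).
    assert ((k * Cmod y) ^ 2 <= (e * Y) ^ 2)%R by (apply pow_incr; lra).
    assert (0 <= (e * Y) ^ 2)%R by (apply pow2_ge_0).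
    nra. }
  assert (A2 : (Cmod (RtoC (2 * k - e) * y) <= e ^ 2 * Y)%R).
  { rewrite Cmod_mult, Cmod_R. apply Rmult_le_compat; auto. apply Rabs_pos. }
  assert (A3 : ((e * Cmod y) ^ 2 <= (e * Y) ^ 2)%R) by (apply pow_incr; split; nra).
  generalize (Cmod_triangle_minus (2 * (k * y) ^ 2 / (1 + k * y)) (RtoC (2 * k - e) * y)).
  intros A4.
  assert (e ^ 2 * Y <= e ^ 2 * Y ^ 2)%R by (apply Rmult_le_compat_l; nra).
  replace ((e * Y) ^ 2)%R with (e ^ 2 * Y ^ 2)%R in * by ring.
  lra.
Qed.

(** There are [S m] factors, each with an error of order e^2, so e of order 1 / n leaves O(1 / n).
    The coupling produced by [cayley_roots] is [e * INR (S m)]; replacing it by [c] is left to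
    [mean_field_lipschitz_c]. *)
Lemma bl_step (m : nat) (e r : R) (w : C) : (0 < e <= 1)%R -> (0 <= r < 1)%R ->
  (Cmod w <= r)%R ->
  (Cmod (bl (S m) (exp (- e)) w - mean_field (e * INR (S m)) w (bl m (exp (- e)) w)) <=
   INR (S m) * (4 * (2 / (1 - r)) ^ 2 * e ^ 2))%R.
Proof.
  intros He Hr Hw.
  assert (Hq : (0 < exp (- e) < 1)%R).
  { split; [apply exp_pos|]. rewrite <- exp_0. apply exp_increasing; lra. }
  destruct (lee_yang (S m) _ Hq) as [a Ha].
  rewrite (bl_product (S m) _ a) by (auto; lra).
  assert (E : mean_field (e * INR (S m)) w (bl m (exp (- e)) w) =
    w * Lprod (fun x => Cexp (- (e) * cayley (- (x * w)))) a).
  { unfold mean_field. rewrite Lprod_Cexp, Lsum_scal, (cayley_roots m (exp (- e))) by (auto; lra).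
    rewrite RtoC_mult. do 2 f_equal. ring. }
  rewrite E.
  match goal with |- (Cmod (?w * ?A - ?w * ?B) <= _)%R =>
    replace (w * A - w * B) with (w * (A - B)) by ring end.
  rewrite Cmod_mult, <- (proj1 Ha).
  rewrite <- (Rmult_1_l (INR (length a) * _)).
  apply Rmult_le_compat; try apply Cmod_ge_0; [lra|].
  apply Lprod_diff. intros x Hx.
  assert (Hxw : (Cmod (x * w) <= r)%R).
  { rewrite Cmod_mult. generalize (proj1 (proj2 Ha) x Hx) (Cmod_ge_0 x) (Cmod_ge_0 w). nra. }
  split; [|split].
  - apply blaschke_factor_le_1; lra.
  - rewrite Cmod_Cexp, <- exp_0. apply exp_le.
    assert (P : (0 < fst (cayley (- (x * w))))%R) by (apply Re_cayley_pos; rewrite Cmod_opp; lra).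
    destruct (cayley (- (x * w))); simpl in *. nra.
  - replace (- (e) * cayley (- (x * w))) with (- (e * cayley (- (x * w)))) by ring.
    now apply blaschke_factor_approx.
Qed.

Lemma mean_field_lipschitz_c (c c' r : R) (w b : C) : (0 <= c)%R -> (0 <= c')%R ->
  (r < 1)%R -> (Cmod w <= 1)%R -> (Cmod b <= r)%R ->
  (Cmod (mean_field c w b - mean_field c' w b) <= Rabs (c - c') * (2 / (1 - r)))%R.
Proof.
  intros Hc Hc' Hr Hw Hb.
  assert (B := cayley_bound b r Hb Hr).
  assert (P := Re_cayley_pos b ltac:(lra)).
  unfold mean_field.
  replace (w * Cexp (- (c * cayley b)) - w * Cexp (- (c' * cayley b))) with
    (w * (Cexp (- (c * cayley b)) - Cexp (- (c' * cayley b)))) by ring.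
  rewrite Cmod_mult.
  assert (L : (Cmod (Cexp (- (c * cayley b)) - Cexp (- (c' * cayley b))) <=
    exp 0 * Cmod (- (c * cayley b) - - (c' * cayley b)))%R).
  { apply Cexp_lipschitz; destruct (cayley b); simpl in *; nra. }
  rewrite exp_0, Rmult_1_l in L.
  replace (- (c * cayley b) - - (c' * cayley b)) with (- (RtoC (c - c') * cayley b)) in L
    by (rewrite RtoC_minus; ring).
  rewrite Cmod_opp, Cmod_mult, Cmod_R in L.
  apply Rle_trans with (1 * (Rabs (c - c') * Cmod (cayley b)))%R.
  - apply Rmult_le_compat; auto; apply Cmod_ge_0.
  - rewrite Rmult_1_l. apply Rmult_le_compat_l; auto. apply Rabs_pos.
Qed.

Lemma div_INR_small (A eps : R) : (0 < eps)%R ->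
  exists N : nat, forall n, (N <= n)%nat -> (1 <= n)%nat /\ (A / INR n < eps)%R.
Proof.
  intros He. destruct (nfloor_ex (Rabs A / eps)%R) as [N [_ HN]].
  { apply Rdiv_le_0_compat; auto. apply Rabs_pos. }
  exists (S N). intros n Hn. split; [lia|].
  assert (Hn' : (INR N + 1 <= INR n)%R) by (rewrite <- S_INR; now apply le_INR).
  generalize (pos_INR N). intros P.
  apply (Rmult_lt_compat_r eps) in HN; auto.
  unfold Rdiv in HN. rewrite Rmult_assoc, Rinv_l, Rmult_1_r in HN by lra.
  apply (proj2 (Rlt_div_l A eps (INR n) ltac:(lra))).
  generalize (Rle_abs A). nra.
Qed.

(** At the start only |x - b| <= 2 and |1 - conj x b| >= 1 - r are known, whence 2 / (1 - r). The
    term with [INR K] pays for the coupling: c - e (m + 1) is at most c K / n on these steps. *)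
Lemma bl_rho_iterate (c r : R) (n K : nat) (w b : C) : (0 < c)%R -> (0 <= r < 1)%R ->
  (c / INR n <= 1)%R -> (S K <= n)%nat -> (Cmod w <= r)%R -> fixed_point c w b ->
  forall j, (j <= K)%nat ->
  (rho (bl (n - 1 - K + j) (exp (- (c / INR n))) w) b <=
   contraction_rate r ^ j * (2 / (1 - r)) +
   INR j * ((4 * (2 / (1 - r)) ^ 2 * c ^ 2 + c * INR K * (2 / (1 - r))) / (1 - r) ^ 2 / INR n))%R.
Proof.
  intros Hc Hr Hcn HK Hw [Hbw Hb] j.
  assert (Pn : (0 < INR n)%R) by (apply lt_0_INR; lia).
  set (e := (c / INR n)%R) in *.
  assert (He : (0 < e <= 1)%R) by (split; auto; apply Rdiv_lt_0_compat; lra).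
  assert (Hq : (0 < exp (- e) < 1)%R).
  { split; [apply exp_pos|]. rewrite <- exp_0. apply exp_increasing; lra. }
  set (Y := (2 / (1 - r))%R).
  set (E := ((4 * Y ^ 2 * c ^ 2 + c * INR K * Y) / (1 - r) ^ 2 / INR n)%R).
  assert (Hbl : forall m, (Cmod (bl m (exp (- e)) w) <= r)%R).
  { intros m. destruct (lee_yang m _ Hq) as [a Ha].
    apply Rle_trans with (Cmod w); auto. apply (bl_bound m _ a); auto; lra. }
  assert (PY : (0 < Y)%R) by (apply Rdiv_lt_0_compat; lra).
  induction j as [|j IH]; intros Hj.
  - rewrite Rmult_0_l, Rplus_0_r, pow_O, Rmult_1_l.
    specialize (Hbl (n - 1 - K + 0)%nat). set (x := bl _ _ _) in *.
    apply rho_le_iff; try lra.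
    assert (D : (1 - r <= Cmod (1 - Cconj x * b))%R).
    { replace (1 - Cconj x * b) with (1 + - (Cconj x * b)) by ring.
      apply Cmod_one_plus_ge. rewrite Cmod_opp, Cmod_mult, Cmod_conj.
      generalize (Cmod_ge_0 x) (Cmod_ge_0 b). nra. }
    apply Rle_trans with (Y * (1 - r))%R; [|apply Rmult_le_compat_l; lra].
    replace (Y * (1 - r))%R with 2%R by (unfold Y; field; lra).
    eapply Rle_trans; [apply Cmod_triangle_minus|]. lra.
  - specialize (IH ltac:(lia)). set (m := (n - 1 - K + j)%nat) in *.
    replace (n - 1 - K + S j)%nat with (S m) by (unfold m; lia).
    assert (Hm : (S m <= n /\ n - S m <= K)%nat) by (unfold m; lia).
    assert (Im : (INR n - INR K <= INR (S m) <= INR n)%R).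
    { split; [rewrite <- minus_INR by lia|]; apply le_INR; lia. }
    assert (Hbm := Hbl m). set (x := bl m (exp (- e)) w) in *.
    assert (Hmf : (Cmod (mean_field c w x) <= r)%R).
    { eapply Rle_trans; [apply mean_field_bound; lra | auto]. }
    eapply Rle_trans; [apply (rho_perturb r (mean_field c w x)); auto; lra|].
    assert (C1 := mean_field_contraction c r w x b Hc Hw (proj2 Hr) ltac:(lra) ltac:(lra)).
    rewrite <- Hb in C1.
    assert (C2 : (contraction_rate r * rho x b <=
      contraction_rate r * (contraction_rate r ^ j * Y + INR j * E))%R).
    { apply Rmult_le_compat_l; auto. now apply contraction_rate_bounds. }
    assert (HE : (0 <= E)%R).
    { unfold E. apply Rdiv_le_0_compat; auto. apply Rdiv_le_0_compat; [|apply pow_lt; lra].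
      generalize (pos_INR K) (pow2_ge_0 Y) (pow2_ge_0 c). intros.
      apply Rplus_le_le_0_compat; apply Rmult_le_pos; try lra; nra. }
    (* The contraction of the errors already made is given away, so they accumulate linearly in [j];
       this is harmless since [j <= K] and [K] does not depend on [n]. *)
    assert (C3 : (contraction_rate r * (INR j * E) <= INR j * E)%R).
    { generalize (contraction_rate_bounds r Hr) (Rmult_le_pos _ _ (pos_INR j) HE). nra. }
    assert (C4 : (Cmod (bl (S m) (exp (- e)) w - mean_field c w x) <=
      (4 * Y ^ 2 * c ^ 2 + c * INR K * Y) / INR n)%R).
    { replace (bl (S m) (exp (- e)) w - mean_field c w x) with
        ((bl (S m) (exp (- e)) w - mean_field (e * INR (S m)) w x) +
         (mean_field (e * INR (S m)) w x - mean_field c w x)) by ring.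
      eapply Rle_trans; [apply Cmod_triangle|].
      assert (S1 := bl_step m e r w He Hr Hw).
      assert (S2 := mean_field_lipschitz_c (e * INR (S m)) c r w x
        ltac:(generalize (pos_INR (S m)); nra) ltac:(lra) ltac:(lra) ltac:(lra) Hbm).
      fold Y in S1, S2. fold x in S1.
      assert (S3 : (INR (S m) * (4 * Y ^ 2 * e ^ 2) <= 4 * Y ^ 2 * c ^ 2 / INR n)%R).
      { replace (4 * Y ^ 2 * c ^ 2 / INR n)%R with (INR n * (4 * Y ^ 2 * e ^ 2))%R
          by (unfold e; field; lra).
        apply Rmult_le_compat_r; [|lra].
        generalize (pow2_ge_0 Y) (pow2_ge_0 e). nra. }
      assert (S4 : (Rabs (e * INR (S m) - c) <= c * INR K / INR n)%R).
      { replace (e * INR (S m) - c)%R with (- (e * (INR n - INR (S m))))%R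
          by (unfold e; field; lra).
        rewrite Rabs_Ropp, Rabs_pos_eq by (apply Rmult_le_pos; lra).
        replace (c * INR K / INR n)%R with (e * INR K)%R by (unfold e; field; lra).
        apply Rmult_le_compat_l; lra. }
      apply (Rmult_le_compat_r Y) in S4; [|lra].
      replace ((4 * Y ^ 2 * c ^ 2 + c * INR K * Y) / INR n)%R with
        (4 * Y ^ 2 * c ^ 2 / INR n + c * INR K / INR n * Y)%R by (field; lra).
      lra. }
    apply (Rmult_le_compat_r (/ (1 - r) ^ 2)) in C4.
    2:{ left. apply Rinv_0_lt_compat, pow_lt. lra. }
    replace ((4 * Y ^ 2 * c ^ 2 + c * INR K * Y) / INR n * / (1 - r) ^ 2)%R with E in C4
      by (unfold E; field; lra).
    rewrite S_INR. change (contraction_rate r ^ S j)%R with (contraction_rate r * contraction_rate r ^ j)%R.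
    unfold Rdiv at 1. lra.
Qed.

(** [K] is chosen first to make the contracted starting error at most eps / 4, then [n], because the
    accumulated error is [A / n] with [A] depending on [K]. Passing from [rho] to the modulus
    doubles the sum. *)
Lemma bl_converges (c r eps : R) : (0 < c)%R -> (0 <= r < 1)%R -> (0 < eps)%R ->
  exists N : nat, forall n, (N <= n)%nat -> (1 <= n)%nat /\
    forall w b, (Cmod w <= r)%R -> fixed_point c w b ->
    (Cmod (bl (n - 1) (exp (- (c / INR n))) w - b) <= eps)%R.
Proof.
  intros Hc Hr He.
  set (Y := (2 / (1 - r))%R).
  assert (PY : (0 < Y)%R) by (apply Rdiv_lt_0_compat; lra).
  destruct (pow_lt_1_zero (contraction_rate r)) with (y := (eps / (4 * Y))%R) as [K HK].
  { generalize (contraction_rate_bounds r Hr). intros. rewrite Rabs_pos_eq; lra. }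
  { apply Rdiv_lt_0_compat; lra. }
  specialize (HK K (le_n K)).
  set (A := (INR K * ((4 * Y ^ 2 * c ^ 2 + c * INR K * Y) / (1 - r) ^ 2))%R).
  destruct (div_INR_small A (eps / 4)) as [N1 H1]; [lra|].
  destruct (div_INR_small c 1) as [N2 H2]; [lra|].
  exists (N1 + N2 + S K)%nat. intros n Hn. split; [lia|]. intros w b Hw Hb.
  destruct (H1 n ltac:(lia)) as [_ G1]. destruct (H2 n ltac:(lia)) as [_ G2].
  assert (I := bl_rho_iterate c r n K w b Hc Hr ltac:(lra) ltac:(lia) Hw Hb K (le_n K)).
  replace (n - 1 - K + K)%nat with (n - 1)%nat in I by lia. fold Y in I.
  set (e := (c / INR n)%R) in *.
  assert (Pn : (0 < INR n)%R) by (apply lt_0_INR; lia).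
  assert (Hq : (0 < exp (- e) < 1)%R).
  { split; [apply exp_pos|]. rewrite <- exp_0. apply exp_increasing.
    assert (0 < e)%R by (apply Rdiv_lt_0_compat; lra). lra. }
  destruct (lee_yang (n - 1) _ Hq) as [a Ha].
  assert (B := bl_bound (n - 1) _ a w Hq Ha ltac:(lra)).
  eapply Rle_trans; [apply Cmod_minus_le_rho; [lra | destruct Hb; lra]|].
  assert (L1 : (contraction_rate r ^ K * Y <= eps / 4)%R).
  { apply Rle_trans with (eps / (4 * Y) * Y)%R; [|right; field; lra].
    apply Rmult_le_compat_r; [lra|]. eapply Rle_trans; [apply Rle_abs | lra]. }
  assert (L2 : (INR K * ((4 * Y ^ 2 * c ^ 2 + c * INR K * Y) / (1 - r) ^ 2 / INR n) = A / INR n)%R).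
  { unfold A. field. split; lra. }
  lra.
Qed.

(** * Logarithms *)

(** The principal logarithm on the right half-plane, the region where [atan] of the quotient is the
    argument. It is applied to 1 + b with |b| < 1. *)
Definition Clog (z : C) : C := ((ln (fst z ^ 2 + snd z ^ 2) / 2)%R, atan (snd z / fst z)%R).

Lemma Cexp_Clog (z : C) : (0 < fst z)%R -> Cexp (Clog z) = z.
Proof.
  destruct z as [x y]; intros Hx; unfold Cexp, Clog; cbn -[pow] in *.
  rewrite cos_atan, sin_atan.
  assert (P : (0 < x ^ 2 + y ^ 2)%R) by nra.
  assert (E1 : exp (ln (x ^ 2 + y ^ 2) / 2) = sqrt (x ^ 2 + y ^ 2)).
  { rewrite <- (sqrt_Rsqr (exp _)) by (left; apply exp_pos). f_equal.
    unfold Rsqr. rewrite <- exp_plus.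
    replace (ln (x ^ 2 + y ^ 2) / 2 + ln (x ^ 2 + y ^ 2) / 2)%R with (ln (x ^ 2 + y ^ 2)) by field.
    now apply exp_ln. }
  assert (E2 : (sqrt (x ^ 2 + y ^ 2) = x * sqrt (1 + (y / x)²))%R).
  { transitivity (sqrt (x ^ 2 * (1 + (y / x)²))).
    - f_equal. unfold Rsqr. field. lra.
    - rewrite sqrt_mult_alt by nra. f_equal. rewrite <- Rsqr_pow2. apply sqrt_Rsqr. lra. }
  assert (Q : (0 < sqrt (1 + (y / x)²))%R).
  { apply sqrt_lt_R0. generalize (Rle_0_sqr (y / x)). lra. }
  rewrite E1, E2. f_equal; field; lra.
Qed.

Lemma Clog_1 : Clog 1 = 0.
Proof.
  unfold Clog, RtoC; cbn -[pow]. replace (1 ^ 2 + 0 ^ 2)%R with 1%R by ring.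
  rewrite ln_1. replace (0 / 1)%R with 0%R by field. rewrite atan_0. f_equal. field.
Qed.

Lemma Clog_segment_derive (z d : C) (t : R) : (0 < fst (z + t * d)%C)%R ->
  is_derive (fun s : R => fst (Clog (z + s * d))) t (fst (d / (z + t * d))) /\
  is_derive (fun s : R => snd (Clog (z + s * d))) t (snd (d / (z + t * d))).
Proof.
  destruct z as [x y], d as [u v]. unfold Clog, Cdiv, Cinv; cbn -[pow].
  intros H.
  set (X := (x + (t * u - 0 * v))%R) in *. set (Y := (y + (t * v + 0 * u))%R) in *.
  assert (P : (0 < X ^ 2 + Y ^ 2)%R) by nra.
  split.
  - auto_derive; fold (Rminus (t * u) (0 * v)); fold X Y.
    + exact P.
    + field. simpl in *; lra.
  - auto_derive; fold (Rminus (t * u) (0 * v)); fold X Y.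
    + lra.
    + field. simpl in *; split; nra.
Qed.

Lemma segment_Re_ge (z z' : C) (a t : R) : (a <= fst z)%R -> (a <= fst z')%R -> (0 <= t <= 1)%R ->
  (a <= fst (z + t * (z' - z))%C)%R.
Proof. destruct z, z'; simpl; intros. nra. Qed.

Lemma Cmod_ge_Re (z : C) (a : R) : (a <= fst z)%R -> (a <= Cmod z)%R.
Proof.
  intros H. eapply Rle_trans; [|apply re_le_Cmod].
  eapply Rle_trans; [exact H | apply Rle_abs].
Qed.

Lemma Re_pos_neq_0 (z : C) : (0 < fst z)%R -> z <> 0.
Proof. intros H E. rewrite E in H. simpl in H. lra. Qed.

Lemma Clog_lipschitz (z z' : C) (a : R) : (0 < a)%R -> (a <= fst z)%R -> (a <= fst z')%R ->
  (Cmod (Clog z' - Clog z) <= Cmod (z' - z) / a)%R.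
Proof.
  intros Ha Hz Hz'.
  generalize (C_mean_value (fun t : R => Clog (z + t * (z' - z)))
    (fun t : R => (z' - z) / (z + t * (z' - z))) (Cmod (z' - z) / a)).
  cbv beta. replace (z + 1%R * (z' - z)) with z' by ring.
  replace (z + 0%R * (z' - z)) with z by ring. intros M; apply M; clear M.
  intros t Ht. assert (S := segment_Re_ge z z' a t Hz Hz' Ht).
  destruct (Clog_segment_derive z (z' - z) t ltac:(lra)) as [D1 D2].
  split; [exact D1|split; [exact D2|]].
  rewrite Cmod_div by (apply Re_pos_neq_0; lra).
  apply Rmult_le_compat_l; [apply Cmod_ge_0|].
  apply Rinv_le_contravar; auto. now apply Cmod_ge_Re.
Qed.

Lemma Clog_taylor2 (z z' : C) (a : R) : (0 < a)%R -> (a <= fst z)%R -> (a <= fst z')%R ->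
  (Cmod (Clog z' - Clog z - (z' - z) / z) <= Cmod (z' - z) ^ 2 / a ^ 2)%R.
Proof.
  intros Ha Hz Hz'.
  set (k := (z' - z) / z).
  generalize (C_mean_value (fun t : R => Clog (z + t * (z' - z)) - t * k)
    (fun t : R => (z' - z) / (z + t * (z' - z)) - k) (Cmod (z' - z) ^ 2 / a ^ 2)).
  cbv beta. replace (z + 1%R * (z' - z)) with z' by ring.
  replace (z + 0%R * (z' - z)) with z by ring.
  replace (Clog z' - 1%R * k - (Clog z - 0%R * k)) with (Clog z' - Clog z - k) by ring.
  intros M; apply M; clear M.
  intros t Ht. assert (S := segment_Re_ge z z' a t Hz Hz' Ht).
  destruct (Clog_segment_derive z (z' - z) t ltac:(lra)) as [D1 D2].
  split; [|split].
  - apply (is_derive_minus (fun s : R => fst (Clog (z + s * (z' - z)))) (fun s : R => fst (s * k))); auto.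
    destruct k; simpl. auto_derive; auto; ring.
  - apply (is_derive_minus (fun s : R => snd (Clog (z + s * (z' - z)))) (fun s : R => snd (s * k))); auto.
    destruct k; simpl. auto_derive; auto; ring.
  - assert (N1 : z <> 0) by (apply Re_pos_neq_0; lra).
    assert (N2 : z + t * (z' - z) <> 0) by (apply Re_pos_neq_0; lra).
    replace ((z' - z) / (z + t * (z' - z)) - k) with
      (- (t * (z' - z) ^ 2) / (z * (z + t * (z' - z)))) by (unfold k; field; auto).
    rewrite Cmod_div, Cmod_opp, !Cmod_mult, Cmod_pow, Cmod_R, Rabs_pos_eq
      by (try apply Cmult_neq_0; auto; lra).
    apply Cmod_ge_Re in Hz, S.
    apply Rdiv_le_of_le_mult; [nra|].
    generalize (pow2_ge_0 (Cmod (z' - z))). set (m := (Cmod (z' - z) ^ 2)%R). intros Pm.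
    replace (m / a ^ 2 * (Cmod z * Cmod (z + t * (z' - z))))%R with
      (m * (Cmod z * Cmod (z + t * (z' - z)) / a ^ 2))%R by (field; lra).
    rewrite (Rmult_comm t m). apply Rmult_le_compat_l; auto.
    apply Rle_trans with 1%R; [lra|]. apply Rle_div_of_mult_le; nra.
Qed.

Lemma Re_one_plus_ge (b : C) (r : R) : (Cmod b <= r)%R -> (1 - r <= fst (1 + b)%C)%R.
Proof.
  intros H. generalize (re_le_Cmod b) (Rle_abs (- Re b)). rewrite Rabs_Ropp.
  destruct b; simpl. lra.
Qed.

Lemma Clog_one_plus_bound (b : C) (r : R) : (Cmod b <= r)%R -> (r <= 1 / 2)%R ->
  (Cmod (Clog (1 + b)) <= 2 * r)%R.
Proof.
  intros H Hr.
  assert (L := Clog_lipschitz 1 (1 + b) (1 / 2)%R ltac:(lra)).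
  rewrite Clog_1 in L. replace (Clog (1 + b) - 0) with (Clog (1 + b)) in L by ring.
  replace (1 + b - 1) with b in L by ring.
  eapply Rle_trans; [apply L|].
  - simpl; lra.
  - generalize (Re_one_plus_ge b r H). lra.
  - lra.
Qed.

(** First-order expansion of log (1 + exp(- h) u) in h. One unit of the constant 2 comes from the
    logarithm, one from replacing exp(- h) - 1 by - h. Uniformity in [u] permits averaging over all
    zeros. *)
Lemma Clog_radial_taylor (u : C) (r h : R) : (0 <= r < 1)%R -> (Cmod u <= r)%R -> (0 <= h)%R ->
  (Cmod (Clog (1 + exp (- h) * u) - Clog (1 + u) + h * (u / (1 + u))) <=
   2 / (1 - r) ^ 2 * h ^ 2)%R.
Proof.
  intros Hr Hu Hh.
  assert (Eq : (0 < exp (- h) <= 1)%R).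
  { split; [apply exp_pos|]. rewrite <- exp_0. apply exp_le. lra. }
  assert (Hu' : (Cmod (exp (- h) * u) <= r)%R).
  { rewrite Cmod_mult, Cmod_R, Rabs_pos_eq by lra. generalize (Cmod_ge_0 u). nra. }
  assert (T := Clog_taylor2 (1 + u) (1 + exp (- h) * u) (1 - r) ltac:(lra)
     (Re_one_plus_ge _ _ Hu) (Re_one_plus_ge _ _ Hu')).
  assert (E := Cexp_taylor2 (RtoC (- h)) 0 (Rle_refl 0) ltac:(simpl; lra)).
  rewrite Cexp_RtoC, exp_0, Rmult_1_l, Cmod_R, pow2_abs in E.
  replace ((- h) ^ 2)%R with (h ^ 2)%R in E by ring.
  assert (N : 1 + u <> 0) by (apply one_plus_neq_0; lra).
  replace (Clog (1 + exp (- h) * u) - Clog (1 + u) + h * (u / (1 + u))) with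
    ((Clog (1 + exp (- h) * u) - Clog (1 + u) - (1 + exp (- h) * u - (1 + u)) / (1 + u))
     + (u / (1 + u)) * (exp (- h) - 1 - RtoC (- h)))
    by (rewrite RtoC_opp; field; auto).
  eapply Rle_trans; [apply Cmod_triangle|]. rewrite (Cmod_mult (u / (1 + u))), Cmod_div by auto.
  replace (1 + exp (- h) * u - (1 + u)) with (RtoC (exp (- h) - 1) * u) in T
    by (rewrite RtoC_minus; ring).
  replace (1 + exp (- h) * u - (1 + u)) with (RtoC (exp (- h) - 1) * u)
    by (rewrite RtoC_minus; ring).
  rewrite Cmod_mult, Cmod_R in T.
  assert (A1 : (Rabs (exp (- h) - 1) <= h)%R).
  { rewrite Rabs_left1 by lra. generalize (exp_ineq1_le (- h)). lra. }
  assert (A2 : ((Rabs (exp (- h) - 1) * Cmod u) ^ 2 <= h ^ 2)%R).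
  { apply pow_incr. generalize (Rabs_pos (exp (- h) - 1)) (Cmod_ge_0 u). intros; split; nra. }
  assert (P : (0 < (1 - r) ^ 2)%R) by (apply pow_lt; lra).
  assert (A3 : ((Rabs (exp (- h) - 1) * Cmod u) ^ 2 / (1 - r) ^ 2 <= h ^ 2 / (1 - r) ^ 2)%R).
  { apply Rmult_le_compat_r; auto. left. now apply Rinv_0_lt_compat. }
  assert (L := Cmod_one_plus_ge u r Hu).
  assert (A4 : (Cmod u / Cmod (1 + u) <= 1 / (1 - r) ^ 2)%R).
  { apply Rdiv_le_of_le_mult; [lra|].
    replace (1 / (1 - r) ^ 2 * Cmod (1 + u))%R with (Cmod (1 + u) / (1 - r) ^ 2)%R by (field; lra).
    apply Rle_div_of_mult_le; auto. apply Rle_trans with ((1 - r) ^ 2)%R; [|nra].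
    generalize (Cmod_ge_0 u). nra. }
  assert (A5 : (Cmod u / Cmod (1 + u) * Cmod (exp (- h) - 1 - RtoC (- h)) <=
     1 / (1 - r) ^ 2 * h ^ 2)%R).
  { apply Rmult_le_compat; auto; [|apply Cmod_ge_0].
    apply Rdiv_le_0_compat; [apply Cmod_ge_0 | lra]. }
  unfold Rdiv in *. lra.
Qed.

(** * The limiting free energy along a ray *)

Definition magnetization (b : C) : C := b / (1 + b).

(** The right side of the first limit, for c = sigma^2 / 2 and b = exp(2 i zeta), whose
    magnetization is 1 / (1 + exp(- 2 i zeta)). *)
Definition free_energy (c : R) (b : C) : C := Clog (1 + b) - c * magnetization b ^ 2.

Lemma magnetization_diff (b b' : C) (r : R) : (Cmod b <= r)%R -> (Cmod b' <= r)%R -> (r < 1)%R ->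
  (Cmod (magnetization b' - magnetization b) <= Cmod (b' - b) / (1 - r) ^ 2)%R.
Proof.
  intros Hb Hb' Hr.
  assert (N : 1 + b <> 0) by (apply one_plus_neq_0; lra).
  assert (N' : 1 + b' <> 0) by (apply one_plus_neq_0; lra).
  assert (L := Cmod_one_plus_ge b r Hb). assert (L' := Cmod_one_plus_ge b' r Hb').
  replace (magnetization b' - magnetization b) with ((b' - b) / ((1 + b') * (1 + b)))
    by (unfold magnetization; field; auto).
  rewrite Cmod_div, Cmod_mult by (now apply Cmult_neq_0).
  apply Rmult_le_compat_l; [apply Cmod_ge_0|].
  apply Rinv_le_contravar; [apply pow_lt; lra | nra].
Qed.

Lemma magnetization_bound (b : C) (r : R) : (Cmod b <= r)%R -> (r < 1)%R ->
  (Cmod (magnetization b) <= Cmod b / (1 - r))%R.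
Proof.
  intros Hb Hr. unfold magnetization.
  assert (L := Cmod_one_plus_ge b r Hb).
  rewrite Cmod_div by (apply one_plus_neq_0; lra).
  apply Rmult_le_compat_l; [apply Cmod_ge_0|]. apply Rinv_le_contravar; lra.
Qed.

(* Along [exp (- h) w] the fixed point equation gives, to first order,
   [(b' - b) / (1 + b) = - M h + 2 c M (M' - M)] with [M = magnetization b]; the last term
   cancels against the variation of [c M ^ 2]. *)
Lemma free_energy_radial_taylor (c r : R) : (0 < c)%R -> (0 <= r < 1)%R ->
  exists K : R, (0 <= K)%R /\ forall (w b b' : C) (h : R),
    (Cmod w <= r)%R -> (0 <= h <= 1)%R ->
    fixed_point c w b -> fixed_point c (exp (- h) * w) b' ->
    (Cmod (free_energy c b' - free_energy c b + h * magnetization b) <= K * h ^ 2)%R.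
Proof.
  intros Hc Hr.
  (* [k], [k2] and [Z] bound, per unit of [h], the changes of the fixed point, of its magnetization
     and of the exponent [z] below. *)
  set (k := (2 / ((1 - r) ^ 2 * (1 - contraction_rate r)))%R).
  set (k2 := (k / (1 - r) ^ 2)%R).
  set (Z := (1 + 2 * c * k2)%R).
  exists (exp Z * Z ^ 2 / (1 - r) + k ^ 2 / (1 - r) ^ 2 + c * k2 ^ 2)%R.
  assert (P := contraction_rate_bounds r Hr).
  assert (P2 : (0 < (1 - r) ^ 2)%R) by (apply pow_lt; lra).
  assert (Pk : (0 < k)%R) by (apply Rdiv_lt_0_compat; [lra | apply Rmult_lt_0_compat; lra]).
  assert (Pk2 : (0 < k2)%R) by (apply Rdiv_lt_0_compat; lra).
  assert (PZ : (0 < Z)%R) by (unfold Z; nra).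
  split.
  { repeat apply Rplus_le_le_0_compat.
    - apply Rdiv_le_0_compat; [|lra]. apply Rmult_le_pos; [left; apply exp_pos | apply pow2_ge_0].
    - apply Rdiv_le_0_compat; [apply pow2_ge_0 | lra].
    - apply Rmult_le_pos; [lra | apply pow2_ge_0]. }
  intros w b b' h Hw Hh Hb Hb'.
  assert (Eq : (0 < exp (- h) <= 1)%R).
  { split; [apply exp_pos|]. rewrite <- exp_0. apply exp_le. lra. }
  assert (Cmod (exp (- h) * w) <= r)%R as Hw'.
  { rewrite Cmod_mult, Cmod_R, Rabs_pos_eq by lra. generalize (Cmod_ge_0 w). nra. }
  assert (Dw : (Cmod (exp (- h) * w - w) <= h)%R).
  { replace (exp (- h) * w - w) with (RtoC (exp (- h) - 1) * w) by (rewrite RtoC_minus; ring).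
    rewrite Cmod_mult, Cmod_R, Rabs_left1 by lra.
    generalize (exp_ineq1_le (- h)) (Cmod_ge_0 w). intros. nra. }
  assert (D := fixed_point_lipschitz c r w _ b b' Hc Hr Hw Hw' Hb Hb').
  fold k in D.
  assert (Dh : (Cmod (b' - b) <= k * h)%R).
  { eapply Rle_trans; [exact D|]. apply Rmult_le_compat_l; lra. }
  destruct Hb as [Lb Eb], Hb' as [Lb' Eb'].
  assert (Hbr : (Cmod b <= r)%R) by lra. assert (Hbr' : (Cmod b' <= r)%R) by lra.
  assert (N : 1 + b <> 0) by (apply one_plus_neq_0; lra).
  assert (N' : 1 + b' <> 0) by (apply one_plus_neq_0; lra).
  assert (DM : (Cmod (magnetization b' - magnetization b) <= k2 * h)%R).
  { eapply Rle_trans; [apply (magnetization_diff b b' r); auto; lra|].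
    replace (k2 * h)%R with (k * h / (1 - r) ^ 2)%R by (unfold k2; field; lra).
    apply Rmult_le_compat_r; auto. left. now apply Rinv_0_lt_compat. }
  (* The quotient b' / b is exactly exp z, because cayley b = 1 - 2 M turns the difference of the
     two exponents into 2 c (M' - M). *)
  set (z := - h + 2 * c * (magnetization b' - magnetization b)).
  assert (Ez : b' = b * Cexp z).
  { rewrite Eb' at 1. rewrite Eb at 1. unfold mean_field.
    rewrite <- Cexp_RtoC, (Cmult_comm (Cexp (- h)%R)), <- !Cmult_assoc, <- !Cexp_plus.
    do 2 f_equal. unfold z, cayley, magnetization. rewrite RtoC_opp. field; auto. }
  assert (Hz : (Cmod z <= Z * h)%R).
  { unfold z. eapply Rle_trans; [apply Cmod_triangle|].
    rewrite Cmod_opp, !Cmod_mult, !Cmod_R, !Rabs_pos_eq by lra.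
    unfold Z. nra. }
  assert (R1 : (Cmod (Cexp z - 1 - z) <= exp Z * (Z * h) ^ 2)%R).
  { eapply Rle_trans; [apply (Cexp_taylor2 z Z); [lra|]|].
    - eapply Rle_trans; [apply Rle_abs|]. eapply Rle_trans; [apply re_le_Cmod|]. nra.
    - apply Rmult_le_compat_l; [left; apply exp_pos|]. apply pow_incr. split; auto. apply Cmod_ge_0. }
  assert (R2 := Clog_taylor2 (1 + b) (1 + b') (1 - r) ltac:(lra)
     (Re_one_plus_ge _ _ Hbr) (Re_one_plus_ge _ _ Hbr')).
  replace (1 + b' - (1 + b)) with (b' - b) in R2 by ring.
  (* An exact identity with three second-order remainders; the last one is 2 c M (M' - M) - c (M'^2
     - M^2) = - c (M' - M)^2. *)
  assert (Q : free_energy c b' - free_energy c b + h * magnetization b =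
    (Clog (1 + b') - Clog (1 + b) - (b' - b) / (1 + b))
    + magnetization b * (Cexp z - 1 - z)
    - c * (magnetization b' - magnetization b) ^ 2).
  { transitivity ((Clog (1 + b') - Clog (1 + b) - (b' - b) / (1 + b))
      + magnetization b * (Cexp z - 1) + h * magnetization b
      - c * (magnetization b' ^ 2 - magnetization b ^ 2)).
    - unfold free_energy.
      assert (E : (b' - b) / (1 + b) = magnetization b * (Cexp z - 1)).
      { rewrite Ez. unfold magnetization. field; auto. }
      rewrite E. ring.
    - unfold z at 3. ring. }
  rewrite Q. clear Q.
  eapply Rle_trans; [apply Cmod_triangle_minus|].
  eapply Rle_trans; [apply Rplus_le_compat_r, Cmod_triangle|].
  rewrite !Cmod_mult, Cmod_R, (Rabs_pos_eq c) by lra.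
  assert (Mb : (Cmod (magnetization b) <= 1 / (1 - r))%R).
  { eapply Rle_trans; [apply (magnetization_bound b r); lra|].
    apply Rmult_le_compat_r; [left; apply Rinv_0_lt_compat|]; lra. }
  assert (T1 : (Cmod (magnetization b) * Cmod (Cexp z - 1 - z) <=
    1 / (1 - r) * (exp Z * (Z * h) ^ 2))%R).
  { apply Rmult_le_compat; auto; apply Cmod_ge_0. }
  assert (T2 : (Cmod (b' - b) ^ 2 / (1 - r) ^ 2 <= (k * h) ^ 2 / (1 - r) ^ 2)%R).
  { apply Rmult_le_compat_r; [left; now apply Rinv_0_lt_compat|].
    apply pow_incr. split; auto. apply Cmod_ge_0. }
  assert (T3 : (c * Cmod ((magnetization b' - magnetization b) ^ 2) <= c * (k2 * h) ^ 2)%R).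
  { apply Rmult_le_compat_l; [lra|]. rewrite Cmod_pow. apply pow_incr. split; auto. apply Cmod_ge_0. }
  replace ((exp Z * Z ^ 2 / (1 - r) + k ^ 2 / (1 - r) ^ 2 + c * k2 ^ 2) * h ^ 2)%R with
    (1 / (1 - r) * (exp Z * (Z * h) ^ 2) + (k * h) ^ 2 / (1 - r) ^ 2 + c * (k2 * h) ^ 2)%R
    by (field; lra).
  lra.
Qed.

(** A mean value inequality without differentiability: over n equal steps the quadratic errors sum
    to K T^2 / n, which tends to 0. *)
Lemma increment_by_subdivision (D : R -> C) (e K T : R) : (0 <= T)%R -> (0 <= K)%R ->
  (forall t h, (0 <= t)%R -> (0 <= h <= 1)%R ->
     (Cmod (D (t + h)%R - D t) <= e * h + K * h ^ 2)%R) ->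
  (Cmod (D T - D 0%R) <= e * T)%R.
Proof.
  intros HT HK H.
  apply le_epsilon. intros eta He.
  destruct (nfloor_ex (T + K * T ^ 2 / eta)%R) as [N [_ HN]].
  { apply Rplus_le_le_0_compat; auto. apply Rdiv_le_0_compat; auto. nra. }
  set (n := S N). assert (Hn : (T + K * T ^ 2 / eta < INR n)%R) by (unfold n; now rewrite S_INR).
  assert (P : (0 <= K * T ^ 2 / eta)%R) by (apply Rdiv_le_0_compat; auto; nra).
  assert (Pn : (0 < INR n)%R) by lra.
  set (h := (T / INR n)%R).
  assert (Hh : (0 <= h <= 1)%R).
  { split; [apply Rdiv_le_0_compat; lra|]. apply Rdiv_le_of_le_mult; lra. }
  assert (S : forall j, (Cmod (D (INR j * h)%R - D 0%R) <= INR j * (e * h + K * h ^ 2))%R).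
  { induction j as [|j IH].
    - simpl. rewrite !Rmult_0_l. replace (D 0%R - D 0%R) with (RtoC 0) by ring. rewrite Cmod_0. lra.
    - rewrite S_INR, Rmult_plus_distr_r, Rmult_1_l.
      replace (D (INR j * h + h)%R - D 0%R) with
        ((D (INR j * h + h)%R - D (INR j * h)%R) + (D (INR j * h)%R - D 0%R)) by ring.
      eapply Rle_trans; [apply Cmod_triangle|].
      generalize (H (INR j * h)%R h ltac:(apply Rmult_le_pos; [apply pos_INR | lra]) Hh). lra. }
  specialize (S n). replace (INR n * h)%R with T in S by (unfold h; field; lra).
  eapply Rle_trans; [exact S|].
  replace (INR n * (e * h + K * h ^ 2))%R with (e * T + K * T ^ 2 / INR n)%R by (unfold h; field; lra).
  apply Rplus_le_compat_l.
  apply Rdiv_le_of_le_mult; auto.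
  assert (Q : (K * T ^ 2 / eta * eta <= INR n * eta)%R) by (apply Rmult_le_compat_r; lra).
  replace (K * T ^ 2 / eta * eta)%R with (K * T ^ 2)%R in Q by (field; lra). lra.
Qed.

(** * Continuity and uniqueness of logarithm branches *)

Lemma continuous_of_lipschitz (f : C -> C) (z : C) (K d : R) : (0 < d)%R ->
  (forall z', (Cmod (z' - z) < d)%R -> (Cmod (f z' - f z) <= K * Cmod (z' - z))%R) ->
  continuous f z.
Proof.
  intros Hd H. apply filterlim_locally. intros eps.
  set (K' := (Rabs K + 1)%R). assert (PK : (0 < K')%R) by (unfold K'; generalize (Rabs_pos K); lra).
  (* Balls of the product uniform structure on C control [Cmod] only up to sqrt 2, hence the
     division by 2. *)
  assert (Pd : (0 < Rmin d (eps / K') / 2)%R).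
  { apply Rdiv_lt_0_compat; [|lra]. apply Rmin_case; auto. apply Rdiv_lt_0_compat; auto. apply cond_pos. }
  exists (mkposreal _ Pd). intros z' Hz'.
  assert (L : (Cmod (z' - z) < Rmin d (eps / K'))%R).
  { eapply Rlt_le_trans; [exact (C_NormedModule_mixin_compat2 z z' _ Hz')|]. simpl.
    assert (sqrt 2 <= 2)%R.
    { rewrite <- (sqrt_Rsqr 2) at 2 by lra. apply sqrt_le_1_alt. unfold Rsqr; lra. }
    simpl in Pd. nra. }
  apply C_NormedModule_mixin_compat1.
  change (minus (f z') (f z)) with (f z' - f z).
  eapply Rle_lt_trans; [apply H; eapply Rlt_le_trans; [exact L | apply Rmin_l]|].
  assert (L2 : (Cmod (z' - z) < eps / K')%R) by (eapply Rlt_le_trans; [exact L | apply Rmin_r]).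
  apply (Rmult_lt_compat_r K') in L2; auto.
  replace (eps / K' * K')%R with (pos eps) in L2 by (field; lra).
  eapply Rle_lt_trans; [|exact L2]. rewrite Rmult_comm.
  apply Rmult_le_compat_l; [apply Cmod_ge_0|]. unfold K'. generalize (Rle_abs K). lra.
Qed.

Lemma Im_to_infty_limit_bound (L : C -> C) (eps : R) : (0 < eps)%R ->
  filterlim L Im_to_infty (locally (RtoC 0)) ->
  exists M : R, forall theta : C, (M < Im theta)%R -> (Rabs (snd (L theta)) < eps)%R.
Proof.
  intros He H.
  destruct (H (ball (RtoC 0) eps) (locally_ball _ (mkposreal eps He))) as [M HM].
  exists M. intros theta Ht. destruct (HM theta Ht) as [_ B].
  unfold ball in B; simpl in B. unfold AbsRing_ball, abs, minus, plus, opp in B; simpl in B.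
  now rewrite Ropp_0, Rplus_0_r in B.
Qed.

Lemma cos_eq_1_lower_bound (s : R) : (0 < s)%R -> cos s = 1%R -> (PI < s)%R.
Proof.
  intros Hs E. destruct (Rlt_le_dec PI s) as [|L]; auto. exfalso.
  assert (P := sin_gt_0 (s / 2) ltac:(lra) ltac:(generalize PI_RGT_0; lra)).
  replace s with (2 * (s / 2))%R in E by field. rewrite cos_2a_sin in E. nra.
Qed.

(** On the vertical ray above [theta] the difference [m] of the imaginary parts satisfies cos m = 1.
    If it started positive it would exceed PI, while it is below 2 far up; the intermediate value PI
    contradicts cos PI = -1. *)
Lemma log_branch_diff_not_pos (f L1 L2 : C -> C) (theta : C) :
  is_log_branch f L1 -> is_log_branch f L2 -> upper_half_plane theta ->
  (snd (L1 theta - L2 theta)%C <= 0)%R.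
Proof.
  intros (E1 & C1 & I1) (E2 & C2 & I2) Ht. unfold upper_half_plane in *.
  destruct (Rle_lt_dec (snd (L1 theta - L2 theta)%C) 0) as [|G]; auto. exfalso.
  set (p := fun y : R => ((fst theta, snd theta + y)%R : C)).
  assert (Hp : forall y, (0 <= y)%R -> (0 < Im (p y))%R) by (intros; simpl in *; unfold Im in Ht; lra).
  set (m := fun y => (snd (L1 (p y)) - snd (L2 (p y)))%R).
  assert (Hm : forall y, (0 <= y)%R -> cos (m y) = 1%R).
  { intros y Hy. specialize (Hp y Hy).
    assert (E : Cexp (L1 (p y)) = Cexp (L2 (p y))) by now rewrite E1, E2.
    unfold m. destruct (L1 (p y)) as [a s], (L2 (p y)) as [b t]. simpl.
    assert (Eab : exp a = exp b).
    { apply (f_equal Cmod) in E. now rewrite !Cmod_Cexp in E. }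
    unfold Cexp in E. simpl in E. injection E; intros F1 F2. rewrite Eab in F1, F2.
    generalize (exp_pos b). intros Pb.
    apply Rmult_eq_reg_l in F1; [|lra]. apply Rmult_eq_reg_l in F2; [|lra].
    rewrite cos_minus, F1, F2. generalize (sin2_cos2 t). unfold Rsqr. lra. }
  assert (Cm : forall y, (0 <= y)%R -> continuity_pt (fun y => (m y - PI)%R) y).
  { intros y Hy. specialize (Hp y Hy). apply continuity_pt_filterlim.
    assert (Cp : continuous p y).
    { apply filterlim_locally. intros eps. exists eps. intros y' By. split.
      - apply ball_center.
      - unfold ball in *; simpl in *. unfold AbsRing_ball, abs, minus, plus, opp in *; simpl in *.
        now replace (snd theta + y' + - (snd theta + y))%R with (y' + - y)%R by ring. }
    apply (continuous_minus (fun y => m y) (fun _ => PI)); [|apply continuous_const].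
    apply (continuous_minus (fun y => snd (L1 (p y))) (fun y => snd (L2 (p y)))).
    - apply (continuous_comp (fun y => L1 (p y)) snd); [|apply continuous_snd].
      apply continuous_comp; auto.
    - apply (continuous_comp (fun y => L2 (p y)) snd); [|apply continuous_snd].
      apply continuous_comp; auto. }
  destruct (Im_to_infty_limit_bound L1 1 Rlt_0_1 I1) as [M1 B1].
  destruct (Im_to_infty_limit_bound L2 1 Rlt_0_1 I2) as [M2 B2].
  set (Y := (Rabs M1 + Rabs M2 + 1)%R).
  generalize (Rle_abs M1) (Rle_abs M2) (Rabs_pos M1) (Rabs_pos M2). intros.
  assert (PY : (0 < Y)%R) by (unfold Y; lra).
  assert (HY : (m Y < 2)%R).
  { assert (Im (p Y) = snd theta + Y)%R by reflexivity. unfold Im in Ht.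
    specialize (B1 (p Y) ltac:(unfold Y in *; lra)). specialize (B2 (p Y) ltac:(unfold Y in *; lra)).
    apply Rabs_def2 in B1, B2. unfold m. lra. }
  assert (m0 : (PI < m 0)%R).
  { apply cos_eq_1_lower_bound; [|apply Hm; lra].
    unfold m, p. rewrite Rplus_0_r. destruct theta as [x y]. simpl in *. exact G. }
  assert (P3 : (2 < PI)%R) by (generalize PI2_1; lra).
  destruct (IVT_interv (fun y => - (m y - PI))%R 0 Y) as [y [Hy Ey]]; try lra.
  - intros y Hy. apply continuity_pt_opp. apply Cm. lra.
  - assert (Em : m y = PI) by lra. generalize (Hm y ltac:(lra)). rewrite Em, cos_PI. lra.
Qed.

Lemma log_branch_unique (f L1 L2 : C -> C) (theta : C) :
  is_log_branch f L1 -> is_log_branch f L2 -> upper_half_plane theta -> L1 theta = L2 theta.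
Proof.
  intros H1 H2 Ht.
  assert (A := log_branch_diff_not_pos f L1 L2 theta H1 H2 Ht).
  assert (B := log_branch_diff_not_pos f L2 L1 theta H2 H1 Ht).
  destruct H1 as [E1 _], H2 as [E2 _].
  assert (E : Cexp (L1 theta) = Cexp (L2 theta)) by now rewrite E1, E2.
  apply (f_equal Cmod) in E. rewrite !Cmod_Cexp in E. apply exp_inv in E.
  destruct (L1 theta), (L2 theta). simpl in *. subst. f_equal. lra.
Qed.

(** * The limit theorem *)

Lemma Lsum_bound (f : C -> C) (a : list C) (K : R) :
  (forall x, In x a -> (Cmod (f x) <= K)%R) -> (Cmod (Lsum f a) <= INR (length a) * K)%R.
Proof.
  induction a as [|x a IH]; intros H.
  - simpl. rewrite Cmod_0. lra.
  - cbn [length]. rewrite S_INR. simpl. eapply Rle_trans; [apply Cmod_triangle|].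
    generalize (H x (or_introl eq_refl)) (IH (fun y Hy => H y (or_intror Hy))). lra.
Qed.

Lemma Lsum_plus (f g : C -> C) (a : list C) : Lsum (fun x => f x + g x) a = Lsum f a + Lsum g a.
Proof. induction a as [|x a IH]; simpl; [ring | rewrite IH; ring]. Qed.

Lemma Lsum_minus (f g : C -> C) (a : list C) : Lsum (fun x => f x - g x) a = Lsum f a - Lsum g a.
Proof. induction a as [|x a IH]; simpl; [ring | rewrite IH; ring]. Qed.

Lemma exp_INR_mult (x : R) (k : nat) : (exp x ^ k)%R = exp (INR k * x).
Proof.
  induction k as [|k IH].
  - simpl. now rewrite Rmult_0_l, exp_0.
  - rewrite S_INR, Rmult_plus_distr_r, Rmult_1_l, exp_plus, <- IH. simpl. ring.
Qed.

Lemma exp_opp_lt_1 (e : R) : (0 < e)%R -> (0 < exp (- e) < 1)%R.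
Proof. intros He. split; [apply exp_pos|]. rewrite <- exp_0. apply exp_increasing; lra. Qed.

Lemma Copp_1_neq_0 : - (1) <> 0 :> C.
Proof. intros E. injection E. lra. Qed.

Lemma unitary_hermite_hpoly (n : nat) (s : R) (z : C) :
  unitary_hermite n s z = (- (1)) ^ n * hpoly n (exp (- (s / 2))) (- z).
Proof.
  unfold unitary_hermite, hpoly. rewrite <- Csum_mult_l. apply sum_n_ext_loc. intros j Hj.
  rewrite exp_INR_mult, mult_INR, minus_INR by auto.
  replace (INR j * (INR n - INR j) * - (s / 2))%R with (- (s * INR j * (INR n - INR j) / 2))%R
    by field.
  replace (- z) with (- (1) * z) by ring.
  rewrite Cpow_mult_l, RtoC_mult.
  replace ((- (1)) ^ n) with ((- (1)) ^ (n - j) * (- (1)) ^ j)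
    by (rewrite <- Cpow_add_r; f_equal; lia).
  assert (E : (- (1)) ^ j * (- (1)) ^ j = 1).
  { rewrite <- Cpow_mult_l. replace (- (1) * - (1)) with (RtoC 1) by ring. apply Cpow_1_l. }
  transitivity ((- (1)) ^ (n - j) * RtoC (Binomial.C n j) *
    RtoC (exp (- (s * INR j * (INR n - INR j) / 2))) * z ^ j * ((- (1)) ^ j * (- (1)) ^ j)).
  - rewrite E. as_C; ring.
  - as_C; ring.
Qed.

Lemma unitary_hermite_derive (n : nat) (s : R) (z : C) :
  C_derive (unitary_hermite n s) z = - ((- (1)) ^ n * dhpoly n (exp (- (s / 2))) (- z)).
Proof.
  apply C_derive_of_is_derive.
  apply (is_derive_ext (K := C_AbsRing) (V := AbsRing_NormedModule C_AbsRing)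
    (fun z : C => hpoly n (exp (- (s / 2))) (- z) * (- (1)) ^ n)).
  { intros t. rewrite unitary_hermite_hpoly. apply Cmult_comm. }
  replace (- ((- (1)) ^ n * dhpoly n (exp (- (s / 2))) (- z))) with
    (- (1) * dhpoly n (exp (- (s / 2))) (- z) * (- (1)) ^ n) by ring.
  apply (is_derive_scal_l (K := C_AbsRing) (V := AbsRing_NormedModule C_AbsRing)
    (fun z : C => hpoly n (exp (- (s / 2))) (- z))).
  apply (is_derive_comp (K := C_AbsRing) (V := AbsRing_NormedModule C_AbsRing)
    (hpoly n (exp (- (s / 2)))) (fun z : C => - z)).
  - apply hpoly_derive.
  - apply (is_derive_opp (K := C_AbsRing) (V := AbsRing_NormedModule C_AbsRing) (fun z : C => z)).
    apply (is_derive_id (K := C_AbsRing)).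
Qed.

Lemma Ci_mult_Ci : Ci * Ci = - (1).
Proof. unfold Ci, Cmult, Copp, RtoC; simpl; f_equal; ring. Qed.

Lemma Cmod_Cexp_Ci (theta : C) : Cmod (Cexp (Ci * theta)) = exp (- Im theta).
Proof. rewrite Cmod_Cexp. f_equal. destruct theta; simpl. ring. Qed.

Lemma Cexp_Ci_shift (theta : C) (t : R) :
  Cexp (Ci * (theta + Ci * t)) = exp (- t) * Cexp (Ci * theta).
Proof.
  rewrite <- Cexp_RtoC, <- Cexp_plus. f_equal.
  destruct theta; unfold Ci, RtoC, Cplus, Cmult; simpl. f_equal; ring.
Qed.

Lemma half_in_upper_half_plane (theta : C) :
  upper_half_plane theta -> upper_half_plane (theta / 2).
Proof.
  unfold upper_half_plane. intros H.
  replace (theta / 2) with (RtoC (/ 2) * theta).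
  - rewrite im_scal_l. lra.
  - rewrite RtoC_inv by lra. unfold Cdiv. ring.
Qed.

Definition zeta_point (zeta : C -> C) (theta : C) : C := Cexp (2 * Ci * zeta (theta / 2)).

Lemma Ctan_cayley (z : C) : (0 < Im z)%R -> Ctan z = Ci * cayley (Cexp (2 * Ci * z)).
Proof.
  intros Hz.
  assert (Eb : Cexp (2 * Ci * z) = Cexp (Ci * z) * Cexp (Ci * z)).
  { rewrite <- Cexp_plus. f_equal. ring. }
  assert (Hb : (Cmod (Cexp (2 * Ci * z)) < 1)%R).
  { rewrite Eb, Cmod_mult, Cmod_Cexp_Ci. generalize (exp_opp_lt_1 _ Hz). nra. }
  assert (N := one_plus_neq_0 _ Hb). rewrite Eb in N |- *.
  unfold Ctan, Csin, Ccos, cayley. rewrite Cexp_opp.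
  assert (NE := Cexp_neq_0 (Ci * z)). set (E := Cexp (Ci * z)) in *.
  assert (N2 : RtoC 2 <> 0) by (intros H; apply RtoC_inj in H; lra).
  transitivity ((E * E - 1) / (Ci * (1 + E * E))).
  - field. repeat split; auto; try apply Ci_nz.
  - assert (Ei : / Ci = - Ci) by apply Ci_inv.
    transitivity ((E * E - 1) / (1 + E * E) * / Ci); [field; split; auto; apply Ci_nz|].
    rewrite Ei. field; auto.
Qed.

(** Multiply zeta = theta / 2 + t tan zeta by 2 i and insert tan zeta = i cayley b: the exponent is
    i theta - 2 t cayley b, so t = sigma^2 / 4 becomes c = sigma^2 / 2. *)
Lemma zeta_point_fixed (sigma : R) (zeta : C -> C) (theta : C) : (0 < sigma ^ 2)%R ->
  is_zeta (sigma ^ 2 / 4)%R zeta -> upper_half_plane theta ->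
  fixed_point (sigma ^ 2 / 2) (Cexp (Ci * theta)) (zeta_point zeta theta).
Proof.
  intros Hs Hz Ht.
  destruct (Hz _ (half_in_upper_half_plane _ Ht)) as [Hi E].
  unfold zeta_point. set (z := zeta (theta / 2)) in *.
  rewrite (Ctan_cayley z Hi) in E.
  assert (Hb : (Cmod (Cexp (2 * Ci * z)) < 1)%R).
  { replace (2 * Ci * z) with (Ci * z + Ci * z) by ring.
    rewrite Cexp_plus, Cmod_mult, Cmod_Cexp_Ci. generalize (exp_opp_lt_1 _ Hi). nra. }
  set (b := Cexp (2 * Ci * z)) in *.
  assert (Eb : b = mean_field (sigma ^ 2 / 2) (Cexp (Ci * theta)) b).
  { unfold mean_field. rewrite <- Cexp_plus. unfold b at 1. f_equal.
    replace (Ci * theta) with (2 * Ci * (theta / 2)) by (field; intros H; apply RtoC_inj in H; lra).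
    rewrite <- E.
    replace (sigma ^ 2 / 2)%R with (2 * (sigma ^ 2 / 4))%R by field. rewrite RtoC_mult.
    set (k := RtoC (sigma ^ 2 / 4)).
    transitivity (2 * Ci * z - 2 * k * cayley b - 2 * k * cayley b * (Ci * Ci)); [|ring].
    rewrite Ci_mult_Ci. ring. }
  split; auto. rewrite Eb at 1. apply mean_field_bound; lra.
Qed.

Lemma magnetization_inv (b : C) : b <> 0 -> 1 + b <> 0 -> magnetization b = 1 / (1 + / b).
Proof.
  intros N N'. unfold magnetization. field. split; auto. now rewrite Cplus_comm.
Qed.

Lemma Cexp_zeta_inv (zeta : C -> C) (theta : C) :
  Cexp (- (2) * Ci * zeta (theta / 2)) = / zeta_point zeta theta.
Proof. unfold zeta_point. rewrite <- Cexp_opp. f_equal. ring. Qed.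

Lemma one_plus_inv_zeta (zeta : C -> C) (theta : C) : (Cmod (zeta_point zeta theta) < 1)%R ->
  1 + Cexp (- (2) * Ci * zeta (theta / 2)) <> 0 /\
  magnetization (zeta_point zeta theta) = / (1 + Cexp (- (2) * Ci * zeta (theta / 2))).
Proof.
  intros H. rewrite Cexp_zeta_inv. set (b := zeta_point zeta theta) in *.
  assert (N : b <> 0) by apply Cexp_neq_0.
  assert (N' := one_plus_neq_0 b H).
  assert (N2 : 1 + / b <> 0).
  { intros E. apply N'. transitivity (b * (1 + / b)); [field; auto | rewrite E; ring]. }
  split; auto. rewrite magnetization_inv by auto. field. split; auto. now rewrite Cplus_comm.
Qed.

Lemma magnetization_of_root_sum (n : nat) (q : R) (a : list C) (w : C) : (1 <= n)%nat ->
  (0 < q < 1)%R -> roots_in_disc n q a -> (Cmod w < 1)%R ->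
  Lsum (fun x => - (x * w) / (1 + - (x * w))) a = INR n * magnetization (bl (n - 1) q w).
Proof.
  intros Hn Hq Ha Hw. replace n with (S (n - 1)) in Ha |- * at 1 by lia.
  unfold magnetization. rewrite <- (Lsum_roots (n - 1) q a w Hq Ha Hw), <- Lsum_scal.
  apply Lsum_ext_in. intros x Hx.
  assert (N : 1 - x * w <> 0) by (apply one_minus_neq_0; now apply (roots_in_disc_factor _ q a x w Ha)).
  field. auto.
Qed.

(** The ray length [T], the precision [e] and hence [N] are fixed from [eps], [c] and [r] before
    [n], the zeros and [w] appear, which makes the limit uniform. *)
Lemma free_energy_limit (c r eps : R) : (0 < c)%R -> (0 <= r < 1)%R -> (0 < eps)%R ->
  exists N : nat, forall n, (N <= n)%nat -> (1 <= n)%nat /\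
    forall (a : list C) (w : C) (beta : R -> C),
    roots_in_disc n (exp (- (c / INR n))) a -> (Cmod w <= r)%R ->
    (forall t, (0 <= t)%R -> fixed_point c (exp (- t) * w) (beta t)) ->
    (Cmod (/ INR n * Lsum (fun x => Clog (1 + - (x * w))) a - free_energy c (beta 0%R)) < eps)%R.
Proof.
  intros Hc Hr He.
  (* [d] bounds |w| at the far end of the ray, where the averaged logarithm and the limiting one are
     each at most 2 d and the quadratic term at most 2 c d. *)
  set (d := Rmin (1 / 2) (eps / (4 * (4 + 4 * c)))).
  assert (Hd : (0 < d <= 1 / 2)%R).
  { unfold d. split; [|apply Rmin_l]. apply Rmin_case; [lra|].
    apply Rdiv_lt_0_compat; lra. }
  assert (Hd2 : (d * (4 + 4 * c) <= eps / 4)%R).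
  { apply Rle_trans with (eps / (4 * (4 + 4 * c)) * (4 + 4 * c))%R; [|right; field; lra].
    apply Rmult_le_compat_r; [lra | apply Rmin_r]. }
  set (T := (- ln d)%R).
  assert (ET : exp (- T) = d) by (unfold T; rewrite Ropp_involutive; now apply exp_ln).
  assert (HT : (0 <= T)%R).
  { unfold T. rewrite <- ln_1. generalize (ln_le d 1 (proj1 Hd) ltac:(lra)). rewrite ln_1. lra. }
  set (e := (eps / (4 * (T + 1)))%R).
  assert (Hpe : (0 < e)%R) by (apply Rdiv_lt_0_compat; lra).
  assert (P2 : (0 < (1 - r) ^ 2)%R) by (apply pow_lt; lra).
  (* [magnetization_diff] divides by (1 - r)^2, so this precision leaves [e] for the
     magnetizations. *)
  destruct (bl_converges c r (e * (1 - r) ^ 2)) as [N HN]; auto.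
  { now apply Rmult_lt_0_compat. }
  destruct (free_energy_radial_taylor c r Hc Hr) as (K & HK & HG).
  exists N. intros n Hn. destruct (HN n Hn) as [Hn1 Hbl]. split; auto.
  intros a w beta Ha Hw Hbeta.
  assert (Pn : (0 < INR n)%R) by (apply lt_0_INR; lia).
  assert (Nn : RtoC (INR n) <> 0) by (intros E; apply RtoC_inj in E; lra).
  assert (Hq : (0 < exp (- (c / INR n)) < 1)%R) by (apply exp_opp_lt_1, Rdiv_lt_0_compat; lra).
  set (q := exp (- (c / INR n))) in *.
  assert (Hw' : forall t, (0 <= t)%R -> (Cmod (exp (- t) * w) <= exp (- t) * r)%R /\
    (Cmod (exp (- t) * w) <= r)%R).
  { intros t Ht. assert (0 < exp (- t) <= 1)%R.
    { split; [apply exp_pos|]. rewrite <- exp_0. apply exp_le. lra. }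
    rewrite Cmod_mult, Cmod_R, Rabs_pos_eq by lra. generalize (Cmod_ge_0 w). split; nra. }
  assert (Hx : forall x w', In x a -> (Cmod (- (x * w')) <= Cmod w')%R).
  { intros x w' Hx. rewrite Cmod_opp, Cmod_mult.
    generalize (proj1 (proj2 Ha) x Hx) (Cmod_ge_0 w') (Cmod_ge_0 x). nra. }
  set (L := fun w' => / INR n * Lsum (fun x => Clog (1 + - (x * w'))) a).
  set (D := fun t : R => L (exp (- t) * w) - free_energy c (beta t)).
  assert (E0 : D 0%R = L w - free_energy c (beta 0%R)).
  { unfold D. rewrite Ropp_0, exp_0, Cmult_1_l. reflexivity. }
  fold (L w). rewrite <- E0.
  assert (I : (Cmod (D T - D 0%R) <= e * T)%R).
  { apply (increment_by_subdivision D e (2 / (1 - r) ^ 2 + K) T HT).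
    { apply Rplus_le_le_0_compat; auto. apply Rdiv_le_0_compat; lra. }
    intros t h Ht Hh.
    set (v := exp (- t) * w). destruct (Hw' t Ht) as [_ Hv]. fold v in Hv.
    assert (Ev : exp (- (t + h)) * w = exp (- h) * v).
    { unfold v. rewrite Ropp_plus_distr, exp_plus, RtoC_mult. ring. }
    assert (Fv := Hbeta t Ht). fold v in Fv.
    assert (Fv' := Hbeta (t + h)%R ltac:(lra)). rewrite Ev in Fv'.
    assert (G1 := HG v _ _ h Hv Hh Fv Fv').
    assert (B := Hbl v _ Hv Fv). fold q in B.
    set (bn := bl (n - 1) q v) in *.
    assert (Hbn : (Cmod bn <= r)%R).
    { destruct (lee_yang (n - 1) q Hq) as [a' Ha'].
      apply Rle_trans with (Cmod v); auto. apply (bl_bound _ q a'); auto. lra. }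
    assert (Hbt : (Cmod (beta t) <= r)%R) by (destruct Fv; lra).
    assert (G2 : (Cmod (L (exp (- h) * v)%C - L v + h * magnetization bn) <=
      2 / (1 - r) ^ 2 * h ^ 2)%R).
    { replace (L (exp (- h) * v) - L v + h * magnetization bn) with
        (/ INR n * Lsum (fun x => Clog (1 + exp (- h) * - (x * v)) - Clog (1 + - (x * v))
           + h * (- (x * v) / (1 + - (x * v)))) a).
      - rewrite Cmod_mult, Cmod_inv, Cmod_R, Rabs_pos_eq by (auto; lra).
        apply (Rmult_le_reg_l (INR n)); auto.
        rewrite <- Rmult_assoc, Rinv_r, Rmult_1_l by lra.
        rewrite <- (proj1 Ha) at 1. apply Lsum_bound. intros x Hxa.
        apply Clog_radial_taylor; auto; [|lra].
        eapply Rle_trans; [apply Hx; auto | auto].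
      - rewrite Lsum_plus, Lsum_minus, Lsum_scal.
        rewrite (magnetization_of_root_sum n q) by (auto; lra). fold bn.
        rewrite (Lsum_ext_in (fun x => Clog (1 + exp (- h) * - (x * v)))
          (fun x => Clog (1 + - (x * (exp (- h) * v))))).
        + unfold L. field; auto.
        + intros x _. f_equal. ring. }
    assert (G3 : (Cmod (magnetization bn - magnetization (beta t)) <= e)%R).
    { eapply Rle_trans; [apply (magnetization_diff (beta t) bn r); auto; lra|].
      apply Rdiv_le_of_le_mult; auto. }
    unfold D. rewrite Ev. fold v.
    replace (L (exp (- h) * v) - free_energy c (beta (t + h)%R) - (L v - free_energy c (beta t)))
      with ((L (exp (- h) * v) - L v + h * magnetization bn)
        - (free_energy c (beta (t + h)%R) - free_energy c (beta t) + h * magnetization (beta t))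
        - h * (magnetization bn - magnetization (beta t))) by ring.
    eapply Rle_trans; [apply Cmod_triangle_minus|].
    eapply Rle_trans; [apply Rplus_le_compat_r, Cmod_triangle_minus|].
    rewrite (Cmod_mult h), Cmod_R, Rabs_pos_eq by lra.
    assert (h * Cmod (magnetization bn - magnetization (beta t)) <= h * e)%R
      by (apply Rmult_le_compat_l; lra).
    lra. }
  assert (J : (Cmod (D T) <= d * (4 + 4 * c))%R).
  { unfold D. destruct (Hw' T HT) as [Hv _]. rewrite ET in *. set (v := d * w) in *.
    assert (Hv' : (Cmod v <= d)%R) by nra.
    assert (Fv := Hbeta T HT). rewrite ET in Fv. fold v in Fv. destruct Fv as [Hb _].
    assert (Hbd : (Cmod (beta T) <= d)%R) by lra.
    assert (J1 : (Cmod (L v) <= 2 * d)%R).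
    { unfold L. rewrite Cmod_mult, Cmod_inv, Cmod_R, Rabs_pos_eq by (auto; lra).
      apply (Rmult_le_reg_l (INR n)); auto.
      rewrite <- Rmult_assoc, Rinv_r, Rmult_1_l by lra.
      rewrite <- (proj1 Ha) at 1. apply Lsum_bound. intros x Hxa.
      apply Clog_one_plus_bound; [|lra]. eapply Rle_trans; [apply Hx; auto | auto]. }
    assert (J2 := Clog_one_plus_bound _ d Hbd (proj2 Hd)).
    assert (J3 : (Cmod (magnetization (beta T)) <= 2 * d)%R).
    { eapply Rle_trans; [apply (magnetization_bound _ (1 / 2)%R); lra|].
      apply Rdiv_le_of_le_mult; lra. }
    assert (J4 : (Cmod (magnetization (beta T)) ^ 2 <= 2 * d)%R).
    { generalize (Cmod_ge_0 (magnetization (beta T))). nra. }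
    unfold free_energy.
    eapply Rle_trans; [apply Cmod_triangle_minus|].
    eapply Rle_trans; [apply Rplus_le_compat_l, Cmod_triangle_minus|].
    rewrite (Cmod_mult c), Cmod_pow, Cmod_R, Rabs_pos_eq by lra. nra. }
  replace (D 0%R) with (D T - (D T - D 0%R)) by ring.
  eapply Rle_lt_trans; [apply Cmod_triangle_minus|].
  assert (e * T <= eps / 4)%R.
  { replace (eps / 4)%R with (e * (T + 1))%R by (unfold e; field; lra).
    apply Rmult_le_compat_l; lra. }
  lra.
Qed.

Lemma Cmod_Cexp_lt_1 (theta : C) : upper_half_plane theta -> (Cmod (Cexp (Ci * theta)) < 1)%R.
Proof. intros H. rewrite Cmod_Cexp_Ci. now apply exp_opp_lt_1. Qed.

(** The conditions are stated in w = exp(i theta): the point at infinity becomes w = 0, where a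
    linear bound gives the limit, and Lipschitz bounds on |w| <= r give continuity. *)
Lemma log_branch_intro (f L : C -> C) :
  (forall theta, upper_half_plane theta -> Cexp (L theta) = f theta) ->
  (forall r, (0 <= r < 1)%R -> exists K, (0 <= K)%R /\ forall theta theta',
     upper_half_plane theta -> upper_half_plane theta' ->
     (Cmod (Cexp (Ci * theta)) <= r)%R -> (Cmod (Cexp (Ci * theta')) <= r)%R ->
     (Cmod (L theta' - L theta) <= K * Cmod (Cexp (Ci * theta') - Cexp (Ci * theta)))%R) ->
  (exists K, (0 <= K)%R /\ forall theta, upper_half_plane theta ->
     (Cmod (Cexp (Ci * theta)) <= 1 / 2)%R ->
     (Cmod (L theta) <= K * Cmod (Cexp (Ci * theta)))%R) ->
  is_log_branch f L.
Proof.
  intros H1 H2 (K & PK & H3). split; [exact H1|split].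
  - intros theta Ht. unfold upper_half_plane in Ht.
    destruct (H2 (exp (- (Im theta / 2)))) as (K' & PK' & HK').
    { generalize (exp_opp_lt_1 (Im theta / 2)). lra. }
    apply (continuous_of_lipschitz L theta K' (Im theta / 2)); [lra|].
    intros theta' Ht'.
    assert (Q : (Im theta / 2 <= Im theta')%R).
    { generalize (Rle_trans _ _ _ (Rmax_r _ _) (Rmax_Cmod (theta' - theta))).
      intros B. generalize (Rle_abs (- snd (theta' - theta)%C)). rewrite Rabs_Ropp.
      unfold Im in *. simpl in *. lra. }
    eapply Rle_trans; [apply HK'|].
    + exact Ht.
    + unfold upper_half_plane. lra.
    + rewrite Cmod_Cexp_Ci. apply exp_le. lra.
    + rewrite Cmod_Cexp_Ci. apply exp_le. lra.
    + apply Rmult_le_compat_l; auto.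
      eapply Rle_trans; [apply (Cexp_lipschitz _ _ 0)|].
      * unfold Im in *; simpl in *; lra.
      * unfold Im in *; simpl in *; lra.
      * rewrite exp_0, Rmult_1_l. right.
        replace (Ci * theta' - Ci * theta) with (Ci * (theta' - theta)) by ring.
        rewrite Cmod_mult, Cmod_Ci. ring.
  - intros P [eps HP].
    set (s := Rmin (1 / 2) (eps / (2 * (K + 1)))).
    assert (Hs : (0 < s)%R).
    { unfold s. apply Rmin_case; [lra|]. apply Rdiv_lt_0_compat; [apply cond_pos | lra]. }
    exists (Rmax 0 (- ln s)). intros theta Ht.
    assert (U : upper_half_plane theta) by (unfold upper_half_plane; generalize (Rmax_l 0 (- ln s)); lra).
    assert (W : (Cmod (Cexp (Ci * theta)) <= s)%R).
    { rewrite Cmod_Cexp_Ci. rewrite <- (exp_ln s) by auto. apply exp_le.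
      generalize (Rmax_r 0 (- ln s)). lra. }
    apply HP, C_NormedModule_mixin_compat1.
    change (minus (L theta) (RtoC 0)) with (L theta - 0).
    replace (L theta - 0) with (L theta) by ring.
    eapply Rle_lt_trans.
    { apply H3; auto. eapply Rle_trans; [exact W | apply Rmin_l]. }
    assert (W2 : (Cmod (Cexp (Ci * theta)) <= eps / (2 * (K + 1)))%R)
      by (eapply Rle_trans; [exact W | apply Rmin_r]).
    apply Rle_lt_trans with (K * (eps / (2 * (K + 1))))%R; [now apply Rmult_le_compat_l|].
    replace (K * (eps / (2 * (K + 1))))%R with (eps * (K / (2 * (K + 1))))%R by (field; lra).
    rewrite <- (Rmult_1_r eps) at 2. apply Rmult_lt_compat_l; [apply cond_pos|].
    apply (proj2 (Rlt_div_l K 1 (2 * (K + 1)) ltac:(lra))). lra.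
Qed.

(** The product may wind around 0, but each 1 - x w stays in the right half-plane; the sum of
    principal logarithms is therefore continuous on all of the upper half-plane. *)
Lemma root_sum_log_branch (n : nat) (q : R) (a : list C) : (0 < q < 1)%R -> roots_in_disc n q a ->
  is_log_branch (fun theta => hpoly n q (Cexp (Ci * theta)))
    (fun theta => Lsum (fun x => Clog (1 + - (x * Cexp (Ci * theta)))) a).
Proof.
  intros Hq Ha.
  assert (Hx : forall x w', In x a -> (Cmod (- (x * w')) <= Cmod w')%R).
  { intros x w' Hx. rewrite Cmod_opp, Cmod_mult.
    generalize (proj1 (proj2 Ha) x Hx) (Cmod_ge_0 w') (Cmod_ge_0 x). nra. }
  apply log_branch_intro.
  - intros theta Ht. apply Cmod_Cexp_lt_1 in Ht. set (w := Cexp (Ci * theta)) in *.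
    rewrite <- Lprod_Cexp, (proj2 (proj2 Ha)).
    clear Ha. induction a as [|x a IH]; simpl; auto.
    rewrite IH by (intros; apply Hx; now right). f_equal.
    rewrite Cexp_Clog; [ring|].
    generalize (Re_one_plus_ge _ _ (Hx x w (or_introl eq_refl))). lra.
  - intros r Hr. exists (INR n / (1 - r))%R. split.
    { apply Rdiv_le_0_compat; [apply pos_INR | lra]. }
    intros theta theta' _ _ H H'. set (w := Cexp (Ci * theta)) in *. set (w' := Cexp (Ci * theta')) in *.
    rewrite <- Lsum_minus.
    replace (INR n / (1 - r) * Cmod (w' - w))%R with (INR n * (Cmod (w' - w) / (1 - r)))%R by (field; lra).
    rewrite <- (proj1 Ha). apply Lsum_bound. intros x Hxa.
    eapply Rle_trans; [apply (Clog_lipschitz _ _ (1 - r)); [lra| |]|].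
    + apply Re_one_plus_ge. eapply Rle_trans; [now apply Hx | auto].
    + apply Re_one_plus_ge. eapply Rle_trans; [now apply Hx | auto].
    + apply Rmult_le_compat_r; [left; apply Rinv_0_lt_compat; lra|].
      replace (1 + - (x * w') - (1 + - (x * w))) with (- (x * (w' - w))) by ring. now apply Hx.
  - exists (2 * INR n)%R. split; [generalize (pos_INR n); lra|].
    intros theta _ H. set (w := Cexp (Ci * theta)) in *.
    rewrite (Rmult_comm 2), Rmult_assoc, <- (proj1 Ha). apply Lsum_bound. intros x Hxa.
    now apply Clog_one_plus_bound; [apply Hx|].
Qed.

Lemma fixed_point_log_branch (c : R) (beta : C -> C) : (0 < c)%R ->
  (forall theta, upper_half_plane theta -> fixed_point c (Cexp (Ci * theta)) (beta theta)) ->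
  is_log_branch (fun theta => 1 + beta theta) (fun theta => Clog (1 + beta theta)).
Proof.
  intros Hc Hbeta. apply log_branch_intro.
  - intros theta Ht. destruct (Hbeta theta Ht) as [H _]. apply Cmod_Cexp_lt_1 in Ht.
    apply Cexp_Clog. generalize (Re_one_plus_ge _ _ (Rle_refl (Cmod (beta theta)))). lra.
  - intros r Hr. assert (P := contraction_rate_bounds r Hr).
    set (k := (2 / ((1 - r) ^ 2 * (1 - contraction_rate r)))%R).
    assert (Pk : (0 < k)%R).
    { apply Rdiv_lt_0_compat; [lra|]. apply Rmult_lt_0_compat; [apply pow_lt|]; lra. }
    exists (k / (1 - r))%R. split; [apply Rdiv_le_0_compat; lra|].
    intros theta theta' Ht Ht' H H'.
    assert (F := Hbeta theta Ht). assert (F' := Hbeta theta' Ht').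
    assert (D := fixed_point_lipschitz c r _ _ _ _ Hc Hr H H' F F'). fold k in D.
    destruct F as [F _], F' as [F' _].
    eapply Rle_trans; [apply (Clog_lipschitz _ _ (1 - r)); [lra| |]|].
    + apply Re_one_plus_ge. lra.
    + apply Re_one_plus_ge. lra.
    + replace (1 + beta theta' - (1 + beta theta)) with (beta theta' - beta theta) by ring.
      unfold Rdiv. rewrite (Rmult_comm k), Rmult_assoc, (Rmult_comm _ (/ (1 - r))).
      apply Rmult_le_compat_l; auto. left; apply Rinv_0_lt_compat; lra.
  - exists 2%R. split; [lra|]. intros theta Ht H. destruct (Hbeta theta Ht) as [F _].
    now apply Clog_one_plus_bound.
Qed.

(** A horizontal strip serves as neighbourhood since the estimates depend on |exp(i theta)| only:
    its lower edge keeps this modulus away from 1, its upper edge away from 0. *)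
Lemma locally_Im_between (theta0 : C) : upper_half_plane theta0 ->
  locally theta0 (fun theta : C => (Im theta0 / 2 < Im theta < 2 * Im theta0)%R).
Proof.
  intros H. unfold upper_half_plane in H.
  assert (P : (0 < Im theta0 / 2)%R) by lra.
  exists (mkposreal _ P). intros y [_ B].
  unfold ball in B; simpl in B. unfold AbsRing_ball, abs, minus, plus, opp in B; simpl in B.
  apply Rabs_def2 in B. unfold Im in *. lra.
Qed.

Theorem theorem2p4 :
  forall (sigma : R) (zeta : C -> C),
    (0 < sigma ^ 2)%R ->
    is_zeta (sigma ^ 2 / 4)%R zeta ->
    (forall (logH : nat -> C -> C) (log1 : C -> C),
        (forall n : nat, (1 <= n)%nat ->
           is_log_branch
             (fun theta : C =>
                unitary_hermite n (sigma ^ 2 / INR n)%R (- Cexp (Ci * theta))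
                / (- (1)) ^ n)
             (logH n)) ->
        is_log_branch
          (fun theta : C => 1 + Cexp (2 * Ci * zeta (theta / 2))) log1 ->
        locally_uniform_limit upper_half_plane
          (fun (n : nat) (theta : C) => / RtoC (INR n) * logH n theta)
          (fun theta : C =>
             log1 theta
             - RtoC (sigma ^ 2)%R
               / (2 * (1 + Cexp (- (2) * Ci * zeta (theta / 2))) ^ 2))) /\
    locally_uniform_limit upper_half_plane
      (fun (n : nat) (theta : C) =>
         / RtoC (INR n) *
         (C_derive (unitary_hermite n (sigma ^ 2 / INR n)%R)
            (- Cexp (Ci * theta))
          / unitary_hermite n (sigma ^ 2 / INR n)%R (- Cexp (Ci * theta))))
      (fun theta : C =>
         - Cexp (- (Ci * theta))
         / (1 + Cexp (- (2) * Ci * zeta (theta / 2)))) /\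
    (forall theta : C, upper_half_plane theta ->
       - Cexp (- (Ci * theta))
       / (1 + Cexp (- (2) * Ci * zeta (theta / 2)))
       = - Cexp (- (Ci * theta))
         * (Ci / 2 * Ctan (zeta (theta / 2)) + 1 / 2)).
Proof.
  intros sigma zeta Hs Hz.
  set (c := (sigma ^ 2 / 2)%R). assert (Hc : (0 < c)%R) by (unfold c; lra).
  assert (HF : forall theta, upper_half_plane theta ->
    fixed_point c (Cexp (Ci * theta)) (zeta_point zeta theta))
    by (intros; now apply zeta_point_fixed).
  assert (Hb : forall theta, upper_half_plane theta -> (Cmod (zeta_point zeta theta) < 1)%R).
  { intros theta Ht. destruct (HF theta Ht) as [H _]. generalize (Cmod_Cexp_lt_1 theta Ht). lra. }
  assert (Hq : forall n, (1 <= n)%nat ->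
    exp (- (sigma ^ 2 / INR n / 2)) = exp (- (c / INR n)) /\ (0 < exp (- (c / INR n)) < 1)%R /\
    RtoC (INR n) <> 0).
  { intros n Hn. assert (0 < INR n)%R by (apply lt_0_INR; lia). split; [|split].
    - unfold c. do 2 f_equal. field. lra.
    - apply exp_opp_lt_1, Rdiv_lt_0_compat; lra.
    - intros E. apply RtoC_inj in E. lra. }
  assert (Npow : forall n, (- (1)) ^ n <> 0 :> C) by (intros; apply Cpow_nz, Copp_1_neq_0).
  split; [|split].
  - intros logH log1 HlogH Hlog1 theta0 Ht0.
    exists (fun theta : C => (Im theta0 / 2 < Im theta < 2 * Im theta0)%R).
    split; [now apply locally_Im_between|].
    intros eps Heps.
    assert (Hr : (0 <= exp (- (Im theta0 / 2)) < 1)%R)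
      by (unfold upper_half_plane in Ht0; generalize (exp_opp_lt_1 (Im theta0 / 2)); lra).
    destruct (free_energy_limit c _ eps Hc Hr Heps) as [N HN].
    exists N. intros n Hn theta Ht HU.
    destruct (HN n Hn) as [Hn1 Hlim]. destruct (Hq n Hn1) as (Eq & Bq & Nn).
    destruct (lee_yang n _ Bq) as [a Ha].
    (* By uniqueness of the branch, the arbitrary logarithms of the statement are replaced by
       explicit ones. *)
    assert (E1 : logH n theta = Lsum (fun x => Clog (1 + - (x * Cexp (Ci * theta)))) a).
    { refine (log_branch_unique _ _ (fun th => Lsum (fun x => Clog (1 + - (x * Cexp (Ci * th)))) a)
        theta (HlogH n Hn1) _ Ht).
      destruct (root_sum_log_branch n _ a Bq Ha) as (B1 & B2). split; [|exact B2].
      intros th Hth. rewrite (B1 th Hth), unitary_hermite_hpoly, Eq.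
      replace (- - Cexp (Ci * th)) with (Cexp (Ci * th)) by ring. field. apply Npow. }
    assert (E2 : log1 theta = Clog (1 + zeta_point zeta theta)).
    { exact (log_branch_unique _ _ (fun th => Clog (1 + zeta_point zeta th)) theta Hlog1
        (fixed_point_log_branch c _ Hc HF) Ht). }
    destruct (one_plus_inv_zeta zeta theta (Hb theta Ht)) as [N2 E3].
    assert (E4 : log1 theta - RtoC (sigma ^ 2)%R / (2 * (1 + Cexp (- (2) * Ci * zeta (theta / 2))) ^ 2)
      = free_energy c (zeta_point zeta theta)).
    { unfold free_energy. rewrite E2, E3. unfold c. rewrite RtoC_div by lra. field.
      exact N2. }
    rewrite E1, E4.
    (* Moving up by i t multiplies exp(i theta) by exp(- t), so these are the fixed points along the
       ray. *)
    set (beta := fun t : R => zeta_point zeta (theta + Ci * t)).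
    replace (zeta_point zeta theta) with (beta 0%R)
      by (unfold beta; f_equal; ring).
    apply Hlim; auto.
    + rewrite Cmod_Cexp_Ci. apply exp_le. lra.
    + intros t Ht1. unfold beta. rewrite <- Cexp_Ci_shift. apply HF.
      unfold upper_half_plane in *. destruct theta; simpl in *. lra.
  - intros theta0 Ht0.
    exists (fun theta : C => (Im theta0 / 2 < Im theta < 2 * Im theta0)%R).
    split; [now apply locally_Im_between|].
    intros eps Heps.
    set (r := exp (- (Im theta0 / 2))).
    assert (Hr : (0 <= r < 1)%R)
      by (unfold upper_half_plane in Ht0; generalize (exp_opp_lt_1 (Im theta0 / 2)); unfold r; lra).
    (* An upper bound on the strip for |exp(- i theta)|, the prefactor of the second limit. *)
    set (V := exp (2 * Im theta0)). assert (PV : (0 < V)%R) by apply exp_pos.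
    assert (P2 : (0 < (1 - r) ^ 2)%R) by (apply pow_lt; lra).
    destruct (bl_converges c r (eps / (2 * V) * (1 - r) ^ 2) Hc Hr) as [N HN].
    { apply Rmult_lt_0_compat; auto. apply Rdiv_lt_0_compat; lra. }
    exists N. intros n Hn theta Ht HU.
    destruct (HN n Hn) as [Hn1 Hlim]. destruct (Hq n Hn1) as (Eq & Bq & Nn).
    set (w := Cexp (Ci * theta)).
    assert (Hw : (Cmod w <= r)%R) by (unfold w; rewrite Cmod_Cexp_Ci; apply exp_le; lra).
    assert (B := Hlim w _ Hw (HF theta Ht)). set (q := exp (- (c / INR n))) in *.
    destruct (lee_yang n q Bq) as [a Ha]. destruct (lee_yang (n - 1) q Bq) as [a' Ha'].
    assert (Nh := roots_in_disc_neq_0 n q a w Ha ltac:(lra)).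
    assert (Bb := bl_bound (n - 1) q a' w Bq Ha' ltac:(lra)).
    assert (Nw : w <> 0) by apply Cexp_neq_0.
    destruct (one_plus_inv_zeta zeta theta (Hb theta Ht)) as [N2 E3].
    assert (E4 : - Cexp (- (Ci * theta)) / (1 + Cexp (- (2) * Ci * zeta (theta / 2))) =
      - (/ w) * magnetization (zeta_point zeta theta)).
    { rewrite E3, Cexp_opp. reflexivity. }
    rewrite E4, unitary_hermite_derive, unitary_hermite_hpoly, Eq. fold w q.
    replace (- - w) with w by ring.
    assert (E5 := dhpoly_over_hpoly (n - 1) q w Bq ltac:(lra)).
    replace (S (n - 1)) with n in E5 by lia.
    fold (magnetization (bl (n - 1) q w)) in E5.
    replace (/ INR n * (- ((- (1)) ^ n * dhpoly n q w) / ((- (1)) ^ n * hpoly n q w)))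
      with (- (/ w) * (/ INR n * (w * dhpoly n q w / hpoly n q w))) by (field; auto).
    rewrite E5.
    replace (- / w * (/ INR n * (INR n * magnetization (bl (n - 1) q w))) -
      - / w * magnetization (zeta_point zeta theta)) with
      (- (/ w * (magnetization (bl (n - 1) q w) - magnetization (zeta_point zeta theta))))
      by (field; auto).
    rewrite Cmod_opp, Cmod_mult, Cmod_inv by auto.
    destruct (HF theta Ht) as [Hbw _]. fold w in Hbw.
    assert (M := magnetization_diff (zeta_point zeta theta) (bl (n - 1) q w) r
      ltac:(lra) ltac:(lra) (proj2 Hr)).
    assert (M2 : (Cmod (magnetization (bl (n - 1) q w) - magnetization (zeta_point zeta theta))
      <= eps / (2 * V))%R).
    { eapply Rle_trans; [exact M|]. apply Rdiv_le_of_le_mult; auto. }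
    assert (W : (/ Cmod w <= V)%R).
    { unfold w. rewrite Cmod_Cexp_Ci, <- exp_Ropp, Ropp_involutive. apply exp_le. lra. }
    apply Rle_lt_trans with (V * (eps / (2 * V)))%R.
    + apply Rmult_le_compat; auto; [|apply Cmod_ge_0].
      left. apply Rinv_0_lt_compat, Cmod_gt_0; auto.
    + replace (V * (eps / (2 * V)))%R with (eps / 2)%R by (field; lra). lra.
  - intros theta Ht.
    destruct (one_plus_inv_zeta zeta theta (Hb theta Ht)) as [N2 E3].
    destruct (Hz _ (half_in_upper_half_plane _ Ht)) as [Hi _].
    unfold Cdiv at 1. rewrite <- E3, (Ctan_cayley _ Hi). f_equal.
    fold (zeta_point zeta theta). assert (N := one_plus_neq_0 _ (Hb theta Ht)).
    set (b := zeta_point zeta theta) in *.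
    assert (NR : RtoC 2 <> 0) by (intros E; apply RtoC_inj in E; lra).
    (* The bracket becomes (1 - cayley b) / 2, which is b / (1 + b). *)
    replace (Ci / 2 * (Ci * cayley b)) with ((Ci * Ci) * cayley b / 2) by (field; auto).
    rewrite Ci_mult_Ci. unfold magnetization, cayley. field; auto.
Qed.
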